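(* Let $A\in\mathbb{R}^{n\times n}$, $T>0$, $X_0,U\in\mathbb{A}_n$. For $N\in\mathbb{N}$ let $\tau=T/N$, $\epsilon_h=1-1/N^2$, $\epsilon_u=1-1/N$, and assume $\tau\in\mathbb{I}$ and $\tau\|A\|\le1$. Let $\mathcal{S}_i^N,\mathcal{V}_i^N,\mathcal{W}_i^N,\Lambda_i^N$ ($i\in\{0,\dots,N\}$) be defined by $\mathcal{S}_0^N=X_0$, $\mathcal{S}_i^N=\mathcal{H}(\tau,\mathcal{S}_{i-1}^N,\epsilon_h)$; $\mathcal{V}_0^N=\mathcal{I}(\tau,U,\epsilon_u)$, $\mathcal{V}_i^N=\mathcal{H}(\tau,\mathcal{V}_{i-1}^N,\epsilon_h)$; $\mathcal{W}_0^N=\{0\}$, $\mathcal{W}_i^N=\mathcal{W}_{i-1}^N+\mathcal{V}_{i-1}^N$; $\Lambda_i^N=\mathcal{S}_i^N+\mathcal{W}_i^N$. Then there exist constants $D_1,D_2,D_3,D_4\ge0$, independent of $N$, such that for every such $N$ and all $i\in\{0,\dots,N\}$: $\mathfrak{d}(\mathcal{S}_i^N,\mathcal{R}_h(i\tau))\le D_1\tau$, $\mathfrak{d}(\mathcal{W}_i^N,\mathcal{R}_u(i\tau))\le D_2\tau$, $\mathfrak{d}(\Lambda_i^N,\mathcal{R}(i\tau))\le D_3\tau$, and $\mathfrak{d}\bigl(\bigcup_{i=0}^N\Lambda_i^N,\mathcal{R}([0,T])\bigr)\le D_4\tau$.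
   Context: A norm $\|\cdot\|$ is fixed on each $\mathbb{R}^k$, $\mathbf{B}_k$ is its closed unit ball, matrices carry induced norms, $G^\dagger$ is the Moore–Penrose inverse, $\rho(A)$ the spectral radius. $\mathfrak{d}$ is the Hausdorff distance: $\mathfrak{d}(\Omega,\Gamma)=\inf\{\varepsilon>0:\Omega\subseteq\Gamma+\varepsilon\mathbf{B}_n,\ \Gamma\subseteq\Omega+\varepsilon\mathbf{B}_n\}$. $\mathbb{A}_n$ is the collection of sets $c+G\mathbf{B}_p$, $c\in\mathbb{R}^n$, $G\in\mathbb{R}^{n\times p}$, $\mathrm{rank}(G)=n$, each regarded with its representation $(c,G)$. Set-valued integral $\int_0^tF(s)W\,\mathrm{d}s=\bigcup_w\int_0^tF(s)w(s)\,\mathrm{d}s$ over measurable $w:[0,t]\to W$. $\mathcal{R}_h(t)=\mathrm{e}^{tA}X_0$, $\mathcal{R}_u(t)=\int_0^t\mathrm{e}^{sA}U\,\mathrm{d}s$, $\mathcal{R}(t)=\mathcal{R}_h(t)+\mathcal{R}_u(t)$, $\mathcal{R}([0,T])=\bigcup_{t\in[0,T]}\mathcal{R}(t)$. $\mathbb{I}=\{t\ge0:\int_0^t\mathrm{e}^{sA}\mathrm{d}s\text{ invertible}\}$. $\mathcal{L}(t,k)=\sum_{j=0}^{k-1}(tA)^j/j!$, $\mathcal{T}(t,k)=\sum_{j=0}^{k-1}t^{j+1}A^j/(j+1)!$, $\theta(r,k)=\sum_{j=k}^\infty r^j/j!$. For $\Omega=c+G\mathbf{B}_p$: $\lambda(t,\Omega,k)=\dfrac{1-\mathrm{e}^{t\|A\|}\theta(t\|A\|,k)\|G^\dagger\|\|c\|}{1+\mathrm{e}^{t\|A\|}\theta(t\|A\|,k)\|G^\dagger\|\|G\|}$;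 $k_{\min}(t)=\min\{k\in\mathbb{N}:\theta(t\rho(A),k)\mathrm{e}^{t\rho(A)}<1\}$; $\kappa(t,\Omega,\epsilon)=\min\{k\in\mathbb{N}: k\ge\max(k_{\min}(t),2),\ \lambda(t,\Omega,k)>\epsilon\}$; $\eta(t,\Omega,\epsilon)=\min\{k\in\mathbb{N}:\lambda(t,\Omega,k)>\epsilon,\ \mathcal{T}(t,k)\text{ invertible}\}$ ($t\in\mathbb{I}$). $\mathcal{H}(t,\Omega,\epsilon)=\mathcal{L}(t,\kappa)[c+\lambda(t,\Omega,\kappa)G\mathbf{B}_p]$ with $\kappa=\kappa(t,\Omega,\epsilon)$, represented with center $\mathcal{L}(t,\kappa)c$ and generator matrix $\lambda(t,\Omega,\kappa)\mathcal{L}(t,\kappa)G$; $\mathcal{I}(t,\Omega,\epsilon)=\mathcal{T}(t,\eta)[c+\lambda(t,\Omega,\eta)G\mathbf{B}_p]$ with $\eta=\eta(t,\Omega,\epsilon)$, represented with center $\mathcal{T}(t,\eta)c$ and generator matrix $\lambda(t,\Omega,\eta)\mathcal{T}(t,\eta)G$. *)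

(* Defs.v *)
From HB Require Import structures.
From mathcomp Require Import all_boot all_order all_algebra.
From mathcomp Require Import all_classical all_reals all_analysis.
From mathcomp Require complex.
Import complex.ComplexField.
From Stdlib Require Import ClassicalEpsilon.

Set Implicit Arguments.
Unset Strict Implicit.
Unset Printing Implicit Defensive.

Import Order.TTheory GRing.Theory Num.Theory numFieldNormedType.Exports.
Local Open Scope classical_set_scope.
Local Open Scope ring_scope.

Section Defs.
Variable R : realType.

Definition vnorms := forall k : nat, 'cV[R]_k -> R.

Definition is_norm (k : nat) (nu : 'cV[R]_k -> R) : Prop :=
  [/\ (forall x, 0 <= nu x),
      (forall x, nu x = 0 -> x = 0),
      (forall (a : R) x, nu (a *: x) = `|a| * nu x) &
      (forall x y, nu (x + y) <= nu x + nu y)].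

Variable nu : vnorms.

Definition ball1 (k : nat) : set 'cV[R]_k := [set x | nu x <= 1].

Definition opnorm (m k : nat) (M : 'M[R]_(m, k)) : R :=
  sup [set nu (M *m x) | x in @ball1 k].

Definition msum (n : nat) (X Y : set 'cV[R]_n) : set 'cV[R]_n :=
  [set z | exists x y, [/\ X x, Y y & z = x + y]].

Definition sball (n : nat) (e : R) : set 'cV[R]_n := [set e *: b | b in @ball1 n].

(** Hausdorff distance (extended real; +oo if no admissible epsilon) *)
Definition hausdorff (n : nat) (X Y : set 'cV[R]_n) : \bar R :=
  ereal_inf [set e%:E | e in [set e : R | [/\ 0 < e,
     X `<=` msum Y (@sball n e) & Y `<=` msum X (@sball n e)]]].

Definition zset (n p : nat) (c : 'cV[R]_n) (G : 'M[R]_(n, p)) : set 'cV[R]_n :=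
  [set c + G *m b | b in @ball1 p].

Definition penrose (n p : nat) (G : 'M[R]_(n, p)) (X : 'M[R]_(p, n)) : Prop :=
  [/\ G *m X *m G = G, X *m G *m X = X,
      (G *m X)^T = G *m X & (X *m G)^T = X *m G].

Definition pinv (n p : nat) (G : 'M[R]_(n, p)) : 'M[R]_(p, n) :=
  epsilon (inhabits 0) (penrose G).

Definition specrad (n : nat) (A : 'M[R]_n) : R :=
  sup [set complex.ComplexField.Normc.normc z | z in
        [set z : complex.complex R |
           eigenvalue (map_mx (fun x : R => complex.Complex x 0) A) z]].

Definition expm (n : nat) (M : 'M[R]_n) : 'M[R]_n :=
  limn (fun m => \sum_(j < m) ((j`!%:R)^-1 *: M ^+ j)).

Definition natmin (P : nat -> Prop) : nat :=
  epsilon (inhabits 0%N) (fun k => P k /\ forall j, P j -> (k <= j)%N).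

Definition mxint (m k : nat) (t : R) (F : R -> 'M[R]_(m, k)) : 'M[R]_(m, k) :=
  \matrix_(i, j) Rintegral (@lebesgue_measure R) `[0, t] (fun s => F s i j).

Variable n : nat.
Variable A : 'M[R]_n.

Definition Iset (t : R) : Prop := 0 <= t /\ mxint t (fun s => expm (s *: A)) \in unitmx.

Definition Lpoly (t : R) (k : nat) : 'M[R]_n :=
  \sum_(j < k) ((j`!%:R)^-1 *: (t *: A) ^+ j).

Definition Tpoly (t : R) (k : nat) : 'M[R]_n :=
  \sum_(j < k) (((j.+1)`!%:R)^-1 * t ^+ j.+1) *: A ^+ j.

Definition theta (r : R) (k : nat) : R := limn (fun m => \sum_(k <= j < m) (r ^+ j / j`!%:R)).

Definition lam (p : nat) (t : R) (c : 'cV[R]_n) (G : 'M[R]_(n, p)) (k : nat) : R :=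
  let a := t * opnorm A in
  (1 - expR a * theta a k * opnorm (pinv G) * nu c) /
  (1 + expR a * theta a k * opnorm (pinv G) * opnorm G).

Definition kmin (t : R) : nat :=
  natmin (fun k => theta (t * specrad A) k * expR (t * specrad A) < 1).

Definition kappa (p : nat) (t : R) (c : 'cV[R]_n) (G : 'M[R]_(n, p)) (eps : R) : nat :=
  natmin (fun k => (maxn (kmin t) 2 <= k)%N /\ eps < lam t c G k).

Definition eta (p : nat) (t : R) (c : 'cV[R]_n) (G : 'M[R]_(n, p)) (eps : R) : nat :=
  natmin (fun k => eps < lam t c G k /\ Tpoly t k \in unitmx).

Definition Hrep (p : nat) (t eps : R) (cG : 'cV[R]_n * 'M[R]_(n, p))
  : 'cV[R]_n * 'M[R]_(n, p) :=
  let k := kappa t cG.1 cG.2 eps in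
  (Lpoly t k *m cG.1, lam t cG.1 cG.2 k *: (Lpoly t k *m cG.2)).

Definition Irep (p : nat) (t eps : R) (cG : 'cV[R]_n * 'M[R]_(n, p))
  : 'cV[R]_n * 'M[R]_(n, p) :=
  let k := eta t cG.1 cG.2 eps in
  (Tpoly t k *m cG.1, lam t cG.1 cG.2 k *: (Tpoly t k *m cG.2)).

Definition zsetr (p : nat) (cG : 'cV[R]_n * 'M[R]_(n, p)) : set 'cV[R]_n :=
  zset cG.1 cG.2.

Definition Rh (X0 : set 'cV[R]_n) (t : R) : set 'cV[R]_n :=
  [set expm (t *: A) *m x | x in X0].

Definition Ru (U : set 'cV[R]_n) (t : R) : set 'cV[R]_n :=
  [set v | exists w : R -> 'cV[R]_n,
     [/\ (forall s, 0 <= s <= t -> U (w s)),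
         (forall i, measurable_fun `[0, t] (fun s => w s i 0)) &
         v = \col_i Rintegral (@lebesgue_measure R) `[0, t]
                 (fun s => (expm (s *: A) *m w s) i 0)]].

Definition Rt (X0 U : set 'cV[R]_n) (t : R) : set 'cV[R]_n :=
  msum (Rh X0 t) (Ru U t).

Definition Rreach (X0 U : set 'cV[R]_n) (T : R) : set 'cV[R]_n :=
  [set x | exists t, 0 <= t <= T /\ Rt X0 U t x].

Definition Sseq (p : nat) (tau eh : R) (X0 : 'cV[R]_n * 'M[R]_(n, p)) (i : nat) :=
  iter i (Hrep tau eh) X0.

Definition Vseq (q : nat) (tau eh eu : R) (U : 'cV[R]_n * 'M[R]_(n, q)) (i : nat) :=
  iter i (Hrep tau eh) (Irep tau eu U).

Fixpoint Wseq (q : nat) (tau eh eu : R) (U : 'cV[R]_n * 'M[R]_(n, q)) (i : nat)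
  : set 'cV[R]_n :=
  match i with
  | 0%N => [set 0]
  | i'.+1 => msum (Wseq tau eh eu U i') (zsetr (Vseq tau eh eu U i'))
  end.

Definition Lam (p q : nat) (tau eh eu : R) (X0 : 'cV[R]_n * 'M[R]_(n, p))
  (U : 'cV[R]_n * 'M[R]_(n, q)) (i : nat) : set 'cV[R]_n :=
  msum (zsetr (Sseq tau eh X0 i)) (Wseq tau eh eu U i).

End Defs.

(* Main.v *)
Require Import Defs.
From HB Require Import structures.
From mathcomp Require Import all_boot all_order all_algebra.
From mathcomp Require Import all_classical all_reals all_analysis.
From mathcomp Require Import measurable_realfun.
From mathcomp Require Import ring lra.
Import Order.TTheory GRing.Theory Num.Theory numFieldNormedType.Exports.
Local Open Scope classical_set_scope.
Local Open Scope ring_scope.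

(**
Write E(t) for exp(tA) and r for norm1 A, norm1 being the entrywise l1 norm. Since
E(t + h) = E(t) + h A E(t) + O(h^2), since L(tau, k) = 1 + tau A + O(tau^2) for k >= 2,
and since the scaling factor lambda of H satisfies 1 - 1/N^2 < lambda <= 1, one step of H
multiplies both the center and the generator matrix by E(tau) up to a relative error
O(tau^2), and amplifies the accumulated error by at most e^(tau r). After at most N steps
the generators are within O(tau) of the exact ones. In the same way the generators of
V_i are within O(tau^2) of those of tau E(i tau) U.

On the side of the exact forced response, freezing E(s) at i tau on an interval of length
tau costs O(tau^2), and the mean over the interval of a measurable input with values in U
is a point of U up to an arbitrarily small error. Hence R_u((i + 1) tau) is within
O(tau^2) of R_u(i tau) + tau E(i tau) U, and summing over i gives the O(tau) bound. The
bound on the tube follows because t |-> R(t) is Lipschitz.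
*)

Set Implicit Arguments.
Unset Strict Implicit.
Unset Printing Implicit Defensive.

(** * The entrywise l1 norm of matrices *)

Section Norm1.
Variable R : realType.

Definition norm1 (m n : nat) (M : 'M[R]_(m, n)) : R := \sum_i \sum_j `|M i j|.

Lemma norm1_ge0 m n (M : 'M[R]_(m, n)) : 0 <= norm1 M.
Proof. by apply: sumr_ge0 => i _; apply: sumr_ge0 => j _. Qed.

Lemma norm1_0 m n : norm1 (0 : 'M[R]_(m, n)) = 0.
Proof. by apply: big1 => i _; apply: big1 => j _; rewrite mxE normr0. Qed.

Lemma norm1D m n (M N : 'M[R]_(m, n)) : norm1 (M + N) <= norm1 M + norm1 N.
Proof.
rewrite /norm1 -big_split; apply: ler_sum => i _; rewrite -big_split /=.
by apply: ler_sum => j _; rewrite mxE ler_normD.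
Qed.

Lemma norm1Z m n (a : R) (M : 'M[R]_(m, n)) : norm1 (a *: M) = `|a| * norm1 M.
Proof.
rewrite /norm1 mulr_sumr; apply: eq_bigr => i _; rewrite mulr_sumr.
by apply: eq_bigr => j _; rewrite mxE normrM.
Qed.

Lemma norm1N m n (M : 'M[R]_(m, n)) : norm1 (- M) = norm1 M.
Proof. by rewrite -scaleN1r norm1Z normrN1 mul1r. Qed.

Lemma norm1_sub m n (M N P : 'M[R]_(m, n)) : norm1 (M - P) <= norm1 (M - N) + norm1 (N - P).
Proof. by rewrite -[X in norm1 X](subrKA N); apply: norm1D. Qed.

Lemma norm1_sum m n I (s : seq I) (F : I -> 'M[R]_(m, n)) :
  norm1 (\sum_(i <- s) F i) <= \sum_(i <- s) norm1 (F i).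
Proof.
elim/big_ind2 : _ => //; first by rewrite norm1_0.
by move=> x1 x2 y1 y2 h1 h2; apply: le_trans (norm1D _ _) (lerD h1 h2).
Qed.

Lemma norm1_entry m n (M : 'M[R]_(m, n)) i j : `|M i j| <= norm1 M.
Proof.
rewrite /norm1 (bigD1 i) //= (bigD1 j) //= -addrA lerDl.
apply: addr_ge0; first exact: sumr_ge0.
by apply: sumr_ge0 => ? _; apply: sumr_ge0.
Qed.

Lemma norm1M m n p (M : 'M[R]_(m, n)) (N : 'M[R]_(n, p)) :
  norm1 (M *m N) <= norm1 M * norm1 N.
Proof.
rewrite /norm1 mulr_suml; apply: ler_sum => i _.
under eq_bigr do rewrite mxE.
apply: (@le_trans _ _ (\sum_j \sum_k `|M i k| * `|N k j|)).
  apply: ler_sum => j _; apply: le_trans (ler_norm_sum _ _ _) _.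
  by apply: ler_sum => k _; rewrite normrM.
rewrite exchange_big mulr_suml /=; apply: ler_sum => k _.
rewrite -mulr_sumr; apply: ler_wpM2l => //.
rewrite (bigD1 k) //= lerDl.
by apply: sumr_ge0 => ? _; apply: sumr_ge0.
Qed.

Lemma norm1_eq0 m n (M : 'M[R]_(m, n)) : norm1 M <= 0 -> M = 0.
Proof.
move=> h; apply/matrixP => i j; rewrite mxE; apply/eqP.
by rewrite -normr_eq0 eq_le normr_ge0 (le_trans (norm1_entry M i j)).
Qed.

Lemma le_mx_norm_norm1 m n (M : 'M[R]_(m, n)) : `|M| <= norm1 M.
Proof.
rewrite /Num.norm /= mx_normrE; apply/bigmax_leP; split => [|[i j] _ /=].
  exact: norm1_ge0.
exact: norm1_entry.
Qed.

Lemma norm1_le_mx_norm m n (M : 'M[R]_(m, n)) : norm1 M <= (m * n)%:R * `|M|.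
Proof.
rewrite /norm1.
apply: (@le_trans _ _ (\sum_(i < m) \sum_(j < n) `|M|)).
  apply: ler_sum => i _; apply: ler_sum => j _.
  by rewrite [leRHS]/Num.norm /= mx_normrE; apply/bigmax_geP; right; exists (i, j).
by rewrite !sumr_const !card_ord -mulrnA mulr_natl mulnC.
Qed.

(** A row vector v with v N = 0 satisfies v = v (M - N) M^-1, and the right-hand side is a strict
    contraction of v, so v = 0. This later carries the invertibility of the integral of the
    exponential over to the polynomials T(t, k). *)
Lemma unitmx_near n (M N : 'M[R]_n) : M \in unitmx ->
  norm1 (invmx M) * norm1 (M - N) < 1 -> N \in unitmx.
Proof.
move=> Mu h; rewrite -row_free_unit; apply/inj_row_free => v vN.
have hv : v = v *m (M - N) *m invmx M by rewrite mulmxBr vN subr0 mulmxK.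
have : norm1 v <= norm1 v * (norm1 (invmx M) * norm1 (M - N)).
  rewrite {1}hv (le_trans (norm1M _ _))//.
  rewrite [X in _ <= _ * X]mulrC mulrA; apply: ler_wpM2r; first exact: norm1_ge0.
  exact: norm1M.
move=> h2; apply: norm1_eq0.
have := norm1_ge0 v; set x := norm1 v in h2 *; set y := _ * norm1 _ in h h2.
by move=> x0; rewrite leNgt; apply/negP => xp; clear vN hv; nra.
Qed.

End Norm1.

(** * Matrix polynomials and tails of the scalar exponential series *)

(* norm1 1%:M = n, so a bound on norm1 (A ^+ 0) would degrade with every step of the
   algorithm; hence powers, polynomials and exponentials of A are only ever bounded
   after multiplication by a matrix. *)
Section PowerSeries.
Variables (R : realType) (n : nat) (A : 'M[R]_n).
Let a := norm1 A.

Lemma norm1_exp_mul p (Z : 'M[R]_(n, p)) j : norm1 (A ^+ j *m Z) <= a ^+ j * norm1 Z.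
Proof.
elim: j => [|j ih]; first by rewrite !expr0 mul1mx mul1r.
rewrite exprS -mulmxA (le_trans (norm1M _ _))// exprS -mulrA.
by apply: ler_wpM2l => //; exact: norm1_ge0.
Qed.

Lemma norm1_psum_mul p (Z : 'M[R]_(n, p)) m (f : nat -> R) :
  norm1 ((\sum_(j < m) f j *: A ^+ j) *m Z) <= (\sum_(j < m) `|f j| * a ^+ j) * norm1 Z.
Proof.
rewrite mulmx_suml mulr_suml (le_trans (norm1_sum _ _))//; apply: ler_sum => j _.
rewrite -scalemxAl norm1Z -mulrA; apply: ler_wpM2l => //.
exact: norm1_exp_mul.
Qed.

Lemma exprZ_mx t j : (t *: A) ^+ j = t ^+ j *: A ^+ j.
Proof.
elim: j => [|j ih]; first by rewrite !expr0 scale1r.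
by rewrite !exprS ih -[LHS]/(_ *m _) -scalemxAl -scalemxAr scalerA.
Qed.

Lemma LpolyE t k : Lpoly A t k = \sum_(j < k) (t ^+ j / j`!%:R) *: A ^+ j.
Proof.
by apply: eq_bigr => j _; rewrite exprZ_mx scalerA mulrC.
Qed.

(** The tail theta(x, k) as a finite expression instead of a limit; [theta_exp_tail] identifies the
    two. *)
Definition exp_tail (x : R) k := expR x - \sum_(j < k) x ^+ j / j`!%:R.

Lemma sum_exp_coeff (x : R) k :  \sum_(j < k) x ^+ j / j`!%:R = series (exp_coeff x) k.
Proof. by rewrite /series /= big_mkord. Qed.

Lemma exp_tail_cvg (x : R) : exp_tail x @ \oo --> (0 : R).
Proof.
rewrite -(subrr (expR x)); apply: cvgB; first exact: cvg_cst.
under eq_fun do rewrite sum_exp_coeff.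
exact: is_cvg_series_exp_coeff.
Qed.

Lemma exp_psum_le (x : R) k : 0 <= x -> \sum_(j < k) x ^+ j / j`!%:R <= expR x.
Proof.
move=> x0; rewrite sum_exp_coeff.
apply: (nondecreasing_cvgn_le _ (is_cvg_series_exp_coeff x)).
apply/nondecreasing_seqP => m; rewrite /series /= big_nat_recr //= lerDl.
exact: exp_coeff_ge0.
Qed.

Lemma exp_tail_ge0 (x : R) k : 0 <= x -> 0 <= exp_tail x k.
Proof. by move=> x0; rewrite subr_ge0 exp_psum_le. Qed.

End PowerSeries.

(** Joins the complete and the normed structure of matrices, so that absolute convergence gives
    convergence in [expm_cvg]. *)
HB.instance Definition _ (R : realType) m n := Complete.on 'M[R]_(m, n).

(** * The matrix exponential: convergence, tail bounds, second-order expansion *)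

Section Expm.
Variables (R : realType) (n : nat) (A : 'M[R]_n).
Let a := norm1 A.
Let a0 : 0 <= a. Proof. exact: norm1_ge0. Qed.
Local Notation E t := (expm (t *: A)).

Lemma le_cvg0_limit (x B : R) (f : nat -> R) :
  f @ \oo --> (0 : R) -> (forall m, x <= B + f m) -> x <= B.
Proof.
move=> f0 h; rewrite -[leRHS]addr0.
have c : (fun m => B + f m) @ \oo --> B + 0 by apply: cvgD => //; exact: cvg_cst.
rewrite -(cvg_lim (@Rhausdorff R) c); apply: limr_ge; first by apply/cvg_ex; exists (B + 0).
exact: nearW.
Qed.

Lemma expm_cvg t : Lpoly A t @ \oo --> E t.
Proof.
have c : cvgn (series (fun j => (j`!%:R)^-1 *: (t *: A) ^+ j)).
  apply: (@normed_cvg R 'M[R]_(n, n)).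
  (* The factor [norm1 1%:M] comes from [norm1_exp_mul] applied to the identity. It covers the power
     j = 0, and only convergence is at stake here, so its size does no harm. *)
  pose F j := exp_coeff (`|t| * a) j * norm1 (1%:M : 'M[R]_n).
  have h j : `|(j`!%:R)^-1 *: (t *: A) ^+ j| <= F j.
    apply: le_trans (le_mx_norm_norm1 _) _.
    rewrite exprZ_mx scalerA norm1Z /F /exp_coeff /= normrM normfV normr_nat normrX.
    rewrite -[A ^+ j]mulmx1 exprMn mulrC.
    rewrite [X in _ <= X](_ : _ = (a ^+ j * norm1 (1%:M : 'M[R]_n)) * (j`!%:R^-1 * `|t| ^+ j)); last by ring.
    by apply: ler_wpM2r; [rewrite mulr_ge0 ?invr_ge0 ?exprn_ge0|exact: norm1_exp_mul].
  apply: (series_le_cvg _ _ h).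
  - by move=> j; exact: normr_ge0.
  - move=> j; rewrite /F mulr_ge0 ?norm1_ge0// exp_coeff_ge0// mulr_ge0//.
  rewrite (_ : series F = (fun m => series (exp_coeff (`|t| * a)) m * norm1 (1%:M : 'M[R]_n))).
    by apply: is_cvgMl; exact: is_cvg_series_exp_coeff.
  by apply/funext => m; rewrite /series /= mulr_suml.
rewrite /expm (_ : (fun m => _) = Lpoly A t)// (_ : Lpoly A t = series (fun j => (j`!%:R)^-1 *: (t *: A) ^+ j))//.
by apply/funext => m; rewrite /series /= big_mkord.
Qed.

Lemma Lpoly_tail t p (Z : 'M[R]_(n, p)) m k : 0 <= t ->
  norm1 ((Lpoly A t (m + k) - Lpoly A t m) *m Z) <= exp_tail (t * a) m * norm1 Z.
Proof.
move=> t0; rewrite !LpolyE.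
(* Zero coefficients below m turn the difference into one sum, to which [norm1_psum_mul] applies. *)
pose f j := if (j < m)%N then 0 else t ^+ j / j`!%:R.
have -> : \sum_(j < m + k) (t ^+ j / j`!%:R) *: A ^+ j - \sum_(j < m) (t ^+ j / j`!%:R) *: A ^+ j
    = \sum_(j < m + k) f j *: A ^+ j.
  rewrite !big_split_ord /= [X in _ = X + _]big1 ?add0r; last first.
    by move=> i _; rewrite /f ltn_ord scale0r.
  rewrite addrAC subrr add0r; apply: eq_bigr => i _.
  by rewrite /f ltnNge leq_addr.
apply: (le_trans (norm1_psum_mul _ _ _ _)); apply: ler_wpM2r; first exact: norm1_ge0.
rewrite /exp_tail lerBrDr -/a.
apply: le_trans (exp_psum_le (m + k) (mulr_ge0 t0 a0)).
rewrite !big_split_ord /= big1 ?add0r; last first.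
  by move=> i _; rewrite /f ltn_ord normr0 mul0r.
rewrite [leRHS]addrC; apply: lerD => //; apply: ler_sum => i _.
rewrite /f ltnNge leq_addr /= ger0_norm ?exprMn 1?mulrAC// mulr_ge0// ?exprn_ge0//.
Qed.

Lemma expm_tail t p (Z : 'M[R]_(n, p)) m : 0 <= t ->
  norm1 ((E t - Lpoly A t m) *m Z) <= exp_tail (t * a) m * norm1 Z.
Proof.
move=> t0; apply/ler_addgt0Pl => e e0.
(* Convergence is in the max norm: the denominator absorbs the factor n * n of the comparison with
   [norm1] and the factor [norm1 Z], and the + 1 keeps it positive. *)
have /cvgrPdist_lt/(_ (e / ((n * n)%:R * norm1 Z + 1))) := expm_cvg (t := t).
have d0 : 0 < (n * n)%:R * norm1 Z + 1 by rewrite ltr_wpDl// mulr_ge0// norm1_ge0.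
move=> /(_ (divr_gt0 e0 d0)) [K _ hK].
have := hK (m + K)%N; rewrite /= => /(_ (leq_addl _ _)) hm.
rewrite -(subrKA (Lpoly A t (m + K))) mulmxDl (le_trans (norm1D _ _))//.
apply: lerD; last exact: Lpoly_tail.
apply: (le_trans (norm1M _ _)).
apply: (@le_trans _ _ ((n * n)%:R * (e / ((n * n)%:R * norm1 Z + 1)) * norm1 Z)).
  apply: ler_wpM2r; first exact: norm1_ge0.
  apply: (le_trans (norm1_le_mx_norm _)); apply: ler_wpM2l => //; exact: ltW.
rewrite -[leRHS]mulr1 [leLHS](_ : _ = e * ((n * n)%:R * norm1 Z / ((n * n)%:R * norm1 Z + 1))); last by ring.
apply: ler_wpM2l; first exact: ltW.
by rewrite ler_pdivrMr// mul1r lerDl.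
Qed.

Lemma norm1_Lpoly_mul t p (Z : 'M[R]_(n, p)) k : 0 <= t ->
  norm1 (Lpoly A t k *m Z) <= expR (t * a) * norm1 Z.
Proof.
move=> t0; have := @Lpoly_tail t p Z 0 k t0.
by rewrite /exp_tail add0n {2}/Lpoly !big_ord0 !subr0.
Qed.

Lemma norm1_expm_mul t p (Z : 'M[R]_(n, p)) : 0 <= t ->
  norm1 (E t *m Z) <= expR (t * a) * norm1 Z.
Proof.
move=> t0; have := @expm_tail t p Z 0 t0.
by rewrite /exp_tail {1}/Lpoly !big_ord0 !subr0.
Qed.

(** The remainders q_j of the first-order expansion obey q_(j+1) = (t + h) q_j + (j + 2) h^2
    t^(j+1), which drives the induction. The factor (j + 2)(j + 1) is chosen to cancel against (j +
    2)!, leaving 1 / j!, so that summation over j gives an exponential again. *)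
Lemma exprD_second_order (t h : R) j : 0 <= t -> 0 <= h ->
  0 <= (t + h) ^+ j.+2 - t ^+ j.+2 - j.+2%:R * h * t ^+ j.+1
    <= h ^+ 2 * (j.+2 * j.+1)%:R * (t + h) ^+ j.
Proof.
move=> t0 h0; elim: j => [|j /andP[ih1 ih2]].
  by rewrite !expr2 !expr1 expr0 natrM; apply/andP; split; nra.
set q := _ - _ - _ in ih1 ih2.
have -> : (t + h) ^+ j.+3 - t ^+ j.+3 - j.+3%:R * h * t ^+ j.+2 =
   (t + h) * q + j.+2%:R * h ^+ 2 * t ^+ j.+1.
  by rewrite /q -(natr1 j.+2) !exprS; ring.
have th : t ^+ j.+1 <= (t + h) ^+ j.+1 by rewrite ler_pXn2r ?nnegrE ?lerDl ?addr_ge0.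
apply/andP; split.
  apply: addr_ge0; first by rewrite mulr_ge0// addr_ge0.
  by rewrite !mulr_ge0// ?exprn_ge0.
apply: (@le_trans _ _ ((t + h) * (h ^+ 2 * (j.+2 * j.+1)%:R * (t + h) ^+ j) + j.+2%:R * h ^+ 2 * (t + h) ^+ j.+1)).
  apply: lerD; first by apply: ler_wpM2l => //; rewrite addr_ge0.
  by apply: ler_wpM2l => //; rewrite mulr_ge0// exprn_ge0.
rewrite [leLHS](_ : _ = h ^+ 2 * (j.+2 * j.+2)%:R * (t + h) ^+ j.+1); last first.
  by rewrite !natrM -(natr1 j.+1) [(t + h) ^+ j.+1]exprS; ring.
apply: ler_wpM2r; first by rewrite exprn_ge0// addr_ge0.
by apply: ler_wpM2l; rewrite ?sqr_ge0// ler_nat leq_mul.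
Qed.

Lemma fact_shift2 (j : nat) : (j.+2 * j.+1)%:R / j.+2`!%:R = j`!%:R^-1 :> R.
Proof.
rewrite !factS mulnA [X in _ / X]natrM invfM mulrA divff ?mul1r//.
Qed.

(** The derivative of L(t, m + 2) in t is A L(t, m + 1), whence the shift of the index.
    Coefficientwise this is [exprD_second_order] divided by a factorial; the terms of degree 0 and 1
    vanish. *)
Lemma Lpoly_second_order t h p (Z : 'M[R]_(n, p)) m : 0 <= t -> 0 <= h ->
  norm1 ((Lpoly A (t + h) m.+2 - Lpoly A t m.+2 - h *: (A *m Lpoly A t m.+1)) *m Z)
    <= h ^+ 2 * a ^+ 2 * expR ((t + h) * a) * norm1 Z.
Proof.
move=> t0 h0; rewrite !LpolyE.
(* At j = 0 the truncated predecessor is harmless, since the factor [j%:R] kills the term. *)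
pose q j := ((t + h) ^+ j - t ^+ j - j%:R * h * t ^+ j.-1) / j`!%:R.
rewrite (_ : _ - _ - _ = \sum_(j < m.+2) q j *: A ^+ j); last first.
  rewrite mulmx_sumr scaler_sumr (big_ord_recl m.+1 (fun j : 'I_m.+2 => q j *: A ^+ j)).
  rewrite 2!(big_ord_recl m.+1) /=.
  rewrite {1}/q !expr0 fact0 !mul0r subrr subr0 mul0r scale0r add0r.
  rewrite opprD addrACA subrr add0r -!sumrB; apply: eq_bigr => i _.
  rewrite /q /bump /= add1n -scalemxAr -[A *m _]/(A * _) -exprS scalerA -!scalerBl.
  congr (_ *: _); rewrite factS natrM.
  have f0 : i`!%:R != 0 :> R by rewrite pnatr_eq0 -lt0n fact_gt0.
  have f1 : i.+1%:R != 0 :> R by [].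
  rewrite add0n -[X in X - _]/(_ * _); field; rewrite f0 /=.
  by rewrite -natr1 in f1.
apply: (le_trans (norm1_psum_mul _ _ _ _)); apply: ler_wpM2r; first exact: norm1_ge0.
rewrite 2!big_ord_recl /= /bump /= !add1n.
rewrite {1}/q !expr0 !mul0r subrr subr0 mul0r normr0 mul0r add0r.
rewrite {1}/q /= !expr1 expr0 (_ : t + h - t - _ = 0) ?mul0r ?normr0 ?mul0r ?add0r; last by ring.
rewrite -/a; apply: le_trans (ler_wpM2l _ (exp_psum_le m _)); last 2 first.
  - by rewrite mulr_ge0// exprn_ge0.
  - by rewrite mulr_ge0// addr_ge0.
rewrite mulr_sumr; apply: ler_sum => i _; rewrite /bump /= !add1n.
have /andP[q1 q2] := exprD_second_order i t0 h0.
rewrite /q /= normrM ger0_norm// normfV normr_nat.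
apply: (@le_trans _ _ (h ^+ 2 * (i.+2 * i.+1)%:R * (t + h) ^+ i / i.+2`!%:R * a ^+ i.+2)).
  by apply: ler_wpM2r; [exact: exprn_ge0|apply: ler_wpM2r].
rewrite [leLHS](_ : _ = h ^+ 2 * ((i.+2 * i.+1)%:R / i.+2`!%:R * a ^+ i.+2 * (t + h) ^+ i)); last by ring.
rewrite fact_shift2 exprMn [a ^+ i.+2]exprS [a ^+ i.+1]exprS.
by rewrite [leLHS](_ : _ = h ^+ 2 * a ^+ 2 * ((t + h) ^+ i * a ^+ i / i`!%:R)) //; ring.
Qed.

(** Replacing each exponential by a partial sum costs tails that vanish as m grows, so the bound of
    [Lpoly_second_order] passes to the limit without loss. *)
Lemma expm_second_order t h p (Z : 'M[R]_(n, p)) : 0 <= t -> 0 <= h ->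
  norm1 (E (t + h) *m Z - E t *m Z - h *: (A *m (E t *m Z)))
    <= h ^+ 2 * a ^+ 2 * expR ((t + h) * a) * norm1 Z.
Proof.
move=> t0 h0.
have d m : norm1 (E (t + h) *m Z - E t *m Z - h *: (A *m (E t *m Z))) <=
   (h ^+ 2 * a ^+ 2 * expR ((t + h) * a) * norm1 Z + norm1 Z * exp_tail (t * a) m.+2
     + h * a * norm1 Z * exp_tail (t * a) m.+1) + norm1 Z * exp_tail ((t + h) * a) m.+2.
  rewrite (_ : _ - _ - _ = (Lpoly A (t + h) m.+2 - Lpoly A t m.+2 - h *: (A *m Lpoly A t m.+1)) *m Z
    - (E t - Lpoly A t m.+2) *m Z - h *: (A *m ((E t - Lpoly A t m.+1) *m Z))
    + (E (t + h) - Lpoly A (t + h) m.+2) *m Z); last first.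
    rewrite !mulmxBl -scalemxAl mulmxBr scalerBr -!mulmxA !opprB.
    move: (E (t + h) *m Z) (E t *m Z) (Lpoly A (t + h) m.+2 *m Z) (Lpoly A t m.+2 *m Z)
      (h *: (A *m (expm (t *: A) *m Z))) (h *: (A *m (Lpoly A t m.+1 *m Z))) => x y z w u v.
    by apply/matrixP => i j; rewrite !mxE; ring.
  apply: le_trans (norm1D _ _) _; apply: lerD; last first.
    by rewrite mulrC; apply: expm_tail; rewrite addr_ge0.
  apply: le_trans (norm1D _ _) _; apply: lerD; last first.
    rewrite norm1N norm1Z ger0_norm// -!mulrA; apply: ler_wpM2l => //.
    apply: le_trans (norm1M _ _) _; apply: ler_wpM2l => //.
    by rewrite mulrC; exact: expm_tail.
  apply: le_trans (norm1D _ _) _; apply: lerD; first exact: Lpoly_second_order.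
  by rewrite norm1N mulrC; exact: expm_tail.
apply: (@le_cvg0_limit _ _ (fun m => norm1 Z * exp_tail (t * a) m.+2
    + (h * a * norm1 Z * exp_tail (t * a) m.+1 + norm1 Z * exp_tail ((t + h) * a) m.+2))); last first.
  by move=> m; rewrite !addrA; exact: d.
have c y i C : (fun m => C * exp_tail y (m + i)) @ \oo --> (0 : R).
  rewrite -(mulr0 C); apply: cvgMr.
  by rewrite (cvg_shiftn i (exp_tail y)); exact: exp_tail_cvg.
rewrite -[X in _ --> X]addr0 -[X in _ --> _ + X]addr0.
apply: cvgD; last apply: cvgD.
- by have := c (t * a) 2%N (norm1 Z); under eq_fun do rewrite addn2.
- by have := c (t * a) 1%N (h * a * norm1 Z); under eq_fun do rewrite addn1.
- by have := c ((t + h) * a) 2%N (norm1 Z); under eq_fun do rewrite addn2.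
Qed.
End Expm.

(** * One step of the recursion and the accumulation of its errors *)

Section Propagation.
Variables (R : realType) (n : nat) (A : 'M[R]_n).
Let a := norm1 A.
Let a0 : 0 <= a. Proof. exact: norm1_ge0. Qed.
Local Notation E t := (expm (t *: A)).

(** Equivalent to (1 - x) e^x <= 1, which is 1 - x <= e^(-x) multiplied by e^x. *)
Lemma exp_tail1_le (x : R) : 0 <= x -> exp_tail x 1 <= x * expR x.
Proof.
move=> x0; rewrite /exp_tail big_ord1 expr0 fact0 divr1.
have h : (1 - x) * expR x <= 1.
  have := ler_wpM2r (expR_ge0 x) (expR_ge1Dx (- x)).
  by rewrite -expRD addNr expR0.
by nra.
Qed.

Lemma exp_tail2_le (x : R) : 0 <= x -> exp_tail x 2 <= x ^+ 2 * expR x.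
Proof.
move=> x0; have := exp_tail1_le x0.
rewrite /exp_tail !big_ord_recl !big_ord0 /bump /= fact0 expr0 expr1 !divr1 !addr0 => h.
by have := expR_ge1Dx x; rewrite expr2; nra.
Qed.

(** Here the requirement k >= 2 in [kappa] takes effect: the terms of degree 0 and 1 are exact, and
    what remains is a piece of the tail from degree 2 on. *)
Lemma Lpoly_first_order t p (Y : 'M[R]_(n, p)) k : 0 <= t -> (2 <= k)%N ->
  norm1 (Lpoly A t k *m Y - Y - t *: (A *m Y)) <= t ^+ 2 * a ^+ 2 * expR (t * a) * norm1 Y.
Proof.
move=> t0 k2; have := Lpoly_tail A Y 2 (k - 2) t0.
rewrite subnKC // mulmxBl [in X in _ - X]LpolyE !big_ord_recl big_ord0 /bump /= fact0 expr0 expr1 !divr1.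
rewrite ?addn0 ?expr0 ?expr1 ?divr1 !scale1r addr0 mulmxDl mul1mx -scalemxAl opprD addrA => h.
apply: le_trans h _; apply: ler_wpM2r; first exact: norm1_ge0.
by rewrite -exprMn; apply: exp_tail2_le; rewrite mulr_ge0.
Qed.

(** Splits off t / (j + 1), at most t, from the coefficient of the exponential, so that T is bounded
    by t times a bound for L. *)
Lemma TpolyE t k :
  Tpoly A t k = \sum_(j < k) (t / j.+1%:R * (t ^+ j / j`!%:R)) *: A ^+ j.
Proof.
apply: eq_bigr => j _; congr (_ *: _).
by rewrite factS natrM invfM exprS; ring.
Qed.

Lemma norm1_Tpoly_mul t p (Y : 'M[R]_(n, p)) k : 0 <= t ->
  norm1 (Tpoly A t k *m Y) <= t * expR (t * a) * norm1 Y.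
Proof.
move=> t0; rewrite TpolyE.
apply: (le_trans (norm1_psum_mul _ _ _ (fun j => t / j.+1%:R * (t ^+ j / j`!%:R)))).
apply: ler_wpM2r; first exact: norm1_ge0.
apply: (le_trans _ (ler_wpM2l t0 (exp_psum_le k (mulr_ge0 t0 a0)))).
rewrite mulr_sumr; apply: ler_sum => j _.
rewrite ger0_norm ?mulr_ge0 ?invr_ge0 ?exprn_ge0// exprMn -/a.
rewrite [leLHS](_ : _ = t * (t ^+ j * a ^+ j / j`!%:R) * j.+1%:R^-1); last by ring.
by rewrite ler_piMr ?mulr_ge0 ?invr_ge0 ?exprn_ge0// invf_le1 ?ltr0Sn// ler1n.
Qed.

Lemma Tpoly_first_order t p (Y : 'M[R]_(n, p)) k : 0 <= t -> (0 < k)%N ->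
  norm1 (Tpoly A t k *m Y - t *: Y) <= t ^+ 2 * a * expR (t * a) * norm1 Y.
Proof.
move=> t0; case: k => [//|k] _; rewrite TpolyE big_ord_recl /= fact0 !expr0 !divr1 mulr1.
rewrite mulmxDl -scalemxAl mul1mx addrAC subrr add0r.
under eq_bigr do rewrite /bump /= add1n.
rewrite mulmx_suml (le_trans (norm1_sum _ _))//.
have -> : t ^+ 2 * a * expR (t * a) * norm1 Y = t * ((t * a) * expR (t * a)) * norm1 Y by ring.
have h := exp_tail1_le (mulr_ge0 t0 a0).
apply: (le_trans _ (ler_wpM2r (norm1_ge0 _) (ler_wpM2l t0 h))).
have h2 : \sum_(i < k) (t * a) ^+ i.+1 / i.+1`!%:R <= exp_tail (t * a) 1.
  rewrite /exp_tail big_ord1 lerBrDl.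
  by have := exp_psum_le k.+1 (mulr_ge0 t0 a0); rewrite big_ord_recl.
apply: (le_trans _ (ler_wpM2r (norm1_ge0 _) (ler_wpM2l t0 h2))).
rewrite [t * (\sum_(i < k) _)]mulr_sumr mulr_suml; apply: ler_sum => i _.
rewrite -scalemxAl norm1Z.
apply: (@le_trans _ _ (`|t / i.+2%:R * (t ^+ i.+1 / i.+1`!%:R)| * (a ^+ i.+1 * norm1 Y))).
  by apply: ler_wpM2l => //; exact: norm1_exp_mul.
rewrite [leLHS]mulrA; apply: ler_wpM2r; first exact: norm1_ge0.
rewrite ger0_norm ?mulr_ge0 ?invr_ge0 ?exprn_ge0// exprMn -/a.
rewrite [leLHS](_ : _ = t * (t ^+ i.+1 * a ^+ i.+1 / i.+1`!%:R) * i.+2%:R^-1); last by ring.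
by rewrite ler_piMr ?mulr_ge0 ?invr_ge0 ?exprn_ge0// invf_le1 ?ltr0Sn// ler1n.
Qed.

Lemma expm0_mul p (Y : 'M[R]_(n, p)) : E 0 *m Y = Y.
Proof.
apply/eqP; rewrite -subr_eq0; apply/eqP/norm1_eq0.
have := expm_tail A Y 1 (lexx 0).
rewrite /Lpoly big_ord1 expr0 fact0 invr1 scale1r mulmxBl mul1mx.
by rewrite /exp_tail mul0r expR0 big_ord1 expr0 fact0 divr1 subrr mul0r.
Qed.

Lemma expm_lipschitz T t h p (Y : 'M[R]_(n, p)) : 0 <= t -> 0 <= h -> t + h <= T ->
  norm1 (E (t + h) *m Y - E t *m Y) <= h * ((a + T * a ^+ 2) * expR (T * a)) * norm1 Y.
Proof.
move=> t0 h0 tT.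
have e1 : expR ((t + h) * a) <= expR (T * a) by rewrite ler_expR ler_wpM2r.
have e2 : expR (t * a) <= expR (T * a) by rewrite ler_expR ler_wpM2r//; lra.
have Y0 := norm1_ge0 Y.
rewrite -(subrK (h *: (A *m (E t *m Y))) (_ - _)) (le_trans (norm1D _ _))//.
rewrite [leRHS](_ : _ = h * T * a ^+ 2 * expR (T * a) * norm1 Y + h * (a * (expR (T * a) * norm1 Y))); last by ring.
apply: lerD.
  apply: (le_trans (expm_second_order _ _ t0 h0)); apply: ler_wpM2r => //.
  apply: ler_pM => //; rewrite ?expR_ge0 ?mulr_ge0 ?exprn_ge0//.
  apply: ler_wpM2r; first exact: exprn_ge0.
  by rewrite expr2; apply: ler_wpM2l => //; lra.
rewrite norm1Z ger0_norm//; apply: ler_wpM2l => //.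
apply: (le_trans (norm1M _ _)); apply: ler_wpM2l => //.
apply: le_trans (norm1_expm_mul _ _ t0) _; exact: ler_wpM2r.
Qed.

(** Collects three defects of order tau^2: (tau / T)^2 from the scaling factor, and a^2 tau^2 from
    each of the expansions of L and of the exponential. *)
Definition step_const (T : R) := ((T ^+ 2)^-1 + 2%:R * a ^+ 2) * expR (T * a).

Lemma step_const_ge0 T : 0 <= step_const T.
Proof.
by rewrite mulr_ge0 ?expR_ge0// addr_ge0 ?mulr_ge0 ?exprn_ge0 ?invr_ge0 ?sqr_ge0.
Qed.

(** The lower bound on l is the tolerance 1 - 1/N^2 written with 1/N = tau / T. Since l <= 1, the
    error already present grows only by the factor e^(tau a). *)
Lemma propagation_step T tau t p (Z Y : 'M[R]_(n, p)) k l :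
  0 < T -> 0 <= tau -> 0 <= t -> t + tau <= T -> (2 <= k)%N ->
  0 <= l <= 1 -> 1 - (tau / T) ^+ 2 <= l ->
  norm1 (l *: (Lpoly A tau k *m Z) - E (t + tau) *m Y) <=
    expR (tau * a) * norm1 (Z - E t *m Y) + step_const T * tau ^+ 2 * norm1 Y.
Proof.
move=> T0 tau0 t0 tT k2 /andP[l0 l1] l2.
have Y0 := norm1_ge0 Y.
have e1 : expR (tau * a) * expR (t * a) <= expR (T * a).
  by rewrite -expRD ler_expR -mulrDl ler_wpM2r//; lra.
have e2 : expR ((t + tau) * a) <= expR (T * a) by rewrite ler_expR ler_wpM2r.
have [Ek Et] := (norm1_Lpoly_mul A (E t *m Y) k tau0, norm1_expm_mul A Y t0).
have EY : expR (tau * a) * norm1 (E t *m Y) <= expR (T * a) * norm1 Y.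
  apply: le_trans (ler_wpM2l (expR_ge0 _) Et) _; rewrite mulrA; exact: ler_wpM2r.
(* Three contributions: the propagated old error, the defect 1 - l, and the difference of the
   second-order remainders of L and of the exponential, whose common first-order term tau A E(t) Y
   cancels. *)
rewrite [X in norm1 X](_ : _ = l *: (Lpoly A tau k *m (Z - E t *m Y))
  + (((l - 1) *: (Lpoly A tau k *m (E t *m Y)))
  + ((Lpoly A tau k *m (E t *m Y) - E t *m Y - tau *: (A *m (E t *m Y)))
  - (E (t + tau) *m Y - E t *m Y - tau *: (A *m (E t *m Y)))))); last first.
  rewrite mulmxBr; move: (E t *m Y) (E (t + tau) *m Y) => x y.
  move: (Lpoly A tau k *m x) (Lpoly A tau k *m Z) (A *m x) => u v w.
  by apply/matrixP => i j; rewrite !mxE; ring.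
apply: (le_trans (norm1D _ _)); apply: lerD.
  rewrite norm1Z ger0_norm//; apply: le_trans (norm1_Lpoly_mul A _ k tau0).
  by rewrite ler_piMl ?norm1_ge0.
rewrite [leRHS](_ : _ = (tau / T) ^+ 2 * (expR (T * a) * norm1 Y) +
   (tau ^+ 2 * a ^+ 2 * (expR (T * a) * norm1 Y) + tau ^+ 2 * a ^+ 2 * (expR (T * a) * norm1 Y))); last first.
  by rewrite /step_const expr_div_n; ring.
apply: (le_trans (norm1D _ _)); apply: lerD.
  rewrite norm1Z; apply: ler_pM => //; first exact: norm1_ge0.
    by rewrite ler_norml; apply/andP; split; [lra|have := sqr_ge0 (tau / T); lra].
  exact: le_trans Ek EY.
apply: (le_trans (norm1D _ _)); apply: lerD.
  apply: le_trans (Lpoly_first_order _ tau0 k2) _; rewrite -mulrA.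
  by apply: ler_wpM2l; rewrite ?mulr_ge0// sqr_ge0.
rewrite norm1N; apply: le_trans (expm_second_order _ _ t0 tau0) _.
rewrite -mulrA; apply: ler_wpM2l; first by rewrite mulr_ge0// sqr_ge0.
exact: ler_wpM2r.
Qed.

(** A discrete Gronwall estimate. It serves the centers, with l = 1, as well as the generator
    matrices, with l the scaling factor lambda. *)
Lemma propagation T tau p (Y : 'M[R]_(n, p)) (Z : nat -> 'M[R]_(n, p)) :
  0 < T -> 0 <= tau ->
  (forall i, exists k l, [/\ (2 <= k)%N, 0 <= l <= 1, 1 - (tau / T) ^+ 2 <= l &
     Z i.+1 = l *: (Lpoly A tau k *m Z i)]) ->
  forall i, i%:R * tau <= T ->
  norm1 (Z i - E (i%:R * tau) *m Y) <=
    expR (i%:R * tau * a) * (norm1 (Z 0%N - Y) + i%:R * (step_const T * tau ^+ 2 * norm1 Y)).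
Proof.
move=> T0 tau0 HZ; elim=> [_|i ih]; first by rewrite !mul0r expm0_mul expR0 mul1r addr0.
rewrite -natr1 !mulrDl !mul1r => iT.
have it0 : 0 <= i%:R * tau by rewrite mulr_ge0.
have {}ih := ih (le_trans (ler_wpDr tau0 (lexx _)) iT).
have [k [l [k2 l01 l2 ->]]] := HZ i.
apply: le_trans (propagation_step (Z i) Y T0 tau0 it0 iT k2 l01 l2) _.
rewrite [_ + tau * a]addrC expRD.
set S := step_const T * _ * _.
have S0 : 0 <= S by exact: mulr_ge0 (mulr_ge0 (step_const_ge0 T) (sqr_ge0 tau)) (norm1_ge0 Y).
rewrite addrA [leRHS]mulrDr; apply: lerD.
  by rewrite -mulrA; apply: ler_wpM2l => //; exact: expR_ge0.
(* The new defect S enters bare on the left but multiplied by an exponential of a nonnegative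
   number, hence by at least 1, on the right. *)
rewrite ler_peMl// -expRD (le_trans _ (expR_ge1Dx _))// lerDl.
by rewrite addr_ge0// mulr_ge0.
Qed.

End Propagation.

(** * The scaling factor lambda and the existence of the degree [kappa] *)

Section Scaling.
Variables (R : realType) (nu : vnorms R) (hnu : forall k, is_norm (@nu k)).

(** [natmin] is a choice, meaningful only for an inhabited predicate; [lam_gt] and [Tpoly_unit]
    supply the existence proofs for [kappa] and [eta]. *)
Lemma natminP (P : nat -> Prop) : (exists k, P k) -> P (natmin P).
Proof.
move=> [k Pk].
suff : exists k, P k /\ forall j, P j -> (k <= j)%N.
  by move=> /(ClassicalEpsilon.epsilon_spec (inhabits 0%N)) [].
have ex : exists j, `[< P j >] by exists k; apply/asboolP.
case: (ex_minnP ex) => m /asboolP Pm hm; exists m; split => // j Pj.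
by apply: hm; apply/asboolP.
Qed.

Lemma theta_exp_tail (r : R) k : theta r k = exp_tail r k.
Proof.
apply: (@cvg_lim _ (@Rhausdorff R)); rewrite /exp_tail sum_exp_coeff.
have c : series (exp_coeff r) m - series (exp_coeff r) k @[m --> \oo] --> expR r - series (exp_coeff r) k.
  by apply: cvgB; [exact: is_cvg_series_exp_coeff|exact: cvg_cst].
apply: cvg_trans c; apply: near_eq_cvg; near=> m.
have km : (k <= m)%N by near: m; exact: nbhs_infty_ge.
exact: sub_series_geq.
Unshelve. all: by end_near.
Qed.

Lemma opnorm_ge0 m k (M : 'M[R]_(m, k)) : 0 <= opnorm nu M.
Proof.
have [h1 _ hZ _] := hnu k; have [h2 _ _ _] := hnu m.
rewrite /opnorm; set S := (X in sup X).
(* A set without a supremum has [sup] equal to 0 by default, so boundedness need not be settled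
   first. *)
have [hs|/sup_out -> //] := pselect (has_sup S).
have /(sup_upper_bound hs) : S (nu (M *m 0)).
  by exists 0 => //; rewrite /ball1 /= -(scale0r 0) hZ normr0 mul0r; exact: ler01.
by apply: le_trans; exact: h2.
Qed.

Lemma lam_le1 n (A : 'M[R]_n) p t (c : 'cV[R]_n) (G : 'M[R]_(n, p)) k :
  0 <= t -> lam nu A t c G k <= 1.
Proof.
move=> t0; rewrite /lam theta_exp_tail.
have o0 := opnorm_ge0 A; have o1 := opnorm_ge0 G; have o2 := opnorm_ge0 (Defs.pinv G).
have [nc _ _ _] := hnu n.
set x := expR _ * exp_tail _ _ * opnorm nu (Defs.pinv G).
have x0 : 0 <= x by rewrite !mulr_ge0 ?expR_ge0 ?exp_tail_ge0// mulr_ge0.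
have d1 : 0 <= x * opnorm nu G by rewrite mulr_ge0.
have d2 : 0 <= x * nu c by rewrite mulr_ge0.
by rewrite ler_pdivrMr ?mul1r; lra.
Qed.

Lemma lam_gt n (A : 'M[R]_n) p t (c : 'cV[R]_n) (G : 'M[R]_(n, p)) eps :
  0 <= t -> 0 <= eps < 1 -> exists K, forall k, (K <= k)%N -> eps < lam nu A t c G k.
Proof.
move=> t0 /andP[e0 e1].
have o0 := opnorm_ge0 A; have o1 := opnorm_ge0 G; have o2 := opnorm_ge0 (Defs.pinv G).
have [nc _ _ _] := hnu n; have nc0 := nc c.
set x := t * opnorm nu A; have x0 : 0 <= x by rewrite mulr_ge0.
set B := expR x * opnorm nu (Defs.pinv G).
have B0 : 0 <= B by rewrite mulr_ge0// expR_ge0.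
have D0 : 0 < B * (nu c + opnorm nu G) + 1 by rewrite ltr_wpDl// mulr_ge0// addr_ge0.
(* With q the tail at k, eps < lambda reads B q (nu c + eps |G|) < 1 - eps. As eps <= 1, it is
   enough to bound q by this quotient. *)
have /cvgr0Pnorm_lt/(_ ((1 - eps) / (B * (nu c + opnorm nu G) + 1))) := exp_tail_cvg x.
have e2 : 0 < 1 - eps by lra.
move=> /(_ (divr_gt0 e2 D0)) [K _ hK]; exists K => k /hK /=.
rewrite ger0_norm ?exp_tail_ge0// ltr_pdivlMr// => h.
rewrite /lam theta_exp_tail -/x.
have q0 := exp_tail_ge0 k x0.
rewrite (_ : expR x * exp_tail x k * opnorm nu (Defs.pinv G) = B * exp_tail x k); last by rewrite /B; ring.
move: (exp_tail x k) q0 h => q q0 h.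
have Bq : 0 <= B * q by rewrite mulr_ge0.
rewrite ltr_pdivlMr; last by rewrite ltr_wpDr// mulr_ge0.
have h1 : eps * (B * q * opnorm nu G) <= B * q * opnorm nu G.
  by rewrite ler_piMl ?mulr_ge0//; lra.
move: h h1; rewrite !mulrDr mulr1; set u := opnorm nu G; set v := nu c.
have -> : q * (B * v) = B * q * v by ring.
have -> : q * (B * u) = B * q * u by ring.
by move=> h h1; lra.
Qed.

Lemma Hrep_spec n (A : 'M[R]_n) p t eps (cG : 'cV[R]_n * 'M[R]_(n, p)) :
  0 <= t -> 0 <= eps < 1 -> exists k l, [/\ (2 <= k)%N, eps < l <= 1 &
    Hrep nu A t eps cG = (Lpoly A t k *m cG.1, l *: (Lpoly A t k *m cG.2))].
Proof.
move=> t0 e01; set k := kappa nu A t cG.1 cG.2 eps.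
exists k, (lam nu A t cG.1 cG.2 k).
have [k1 k2] : (maxn (kmin A t) 2 <= k)%N /\ eps < lam nu A t cG.1 cG.2 k.
  apply: (natminP (P := fun k => (maxn (kmin A t) 2 <= k)%N /\ _)).
  have [K hK] := lam_gt A cG.1 cG.2 t0 e01.
  by exists (maxn (maxn (kmin A t) 2) K); split; [exact: leq_maxl|apply: hK; exact: leq_maxr].
split; [by apply: leq_trans k1; exact: leq_maxr|by rewrite k2 lam_le1|by []].
Qed.

End Scaling.

(** * Equivalence of the given norms with [norm1] *)

Section NormEquivalence.
Variables (R : realType) (nu : vnorms R) (hnu : forall k, is_norm (@nu k)).

Lemma vnorm0 k : nu (0 : 'cV[R]_k) = 0.
Proof. by have [_ _ hZ _] := hnu k; rewrite -(scale0r 0) hZ normr0 mul0r. Qed.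

Lemma vnorm_le_norm1 k : exists2 C, 0 < C & forall x : 'cV[R]_k, nu x <= C * norm1 x.
Proof.
have [h0 _ hZ hD] := hnu k.
exists (1 + \sum_(i < k) nu (delta_mx i 0 : 'cV[R]_k)).
  by rewrite ltr_pwDl// sumr_ge0.
move=> x; rewrite [X in nu X]matrix_sum_delta.
apply: (@le_trans _ _ (\sum_(i < k) `|x i 0| * nu (delta_mx i 0 : 'cV[R]_k))).
  elim/big_ind2 : _ => [|u1 u2 v1 v2 h1 h2|i _]; first by rewrite vnorm0.
    exact: le_trans (hD _ _) (lerD h1 h2).
  by rewrite big_ord1 hZ.
rewrite mulrC mulrDr mulr1 mulr_sumr ler_wpDl ?norm1_ge0//.
by apply: ler_sum => i _; apply: ler_wpM2r => //; exact: norm1_entry.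
Qed.

(** By [vnorm_le_norm1] the norm [nu] is Lipschitz, so it attains a minimum on the compact unit
    sphere of the max norm. That minimum is positive by definiteness, and homogeneity extends the
    bound to all vectors. *)
Lemma norm1_le_vnorm k : exists2 C, 0 < C & forall x : 'cV[R]_k, norm1 x <= C * nu x.
Proof.
have [h0 hd hZ hD] := hnu k.
have [B B0 hB] := vnorm_le_norm1 k.
(* Transposed to row vectors, the setting of [bounded_closed_compact] and [EVT_min_rV]. *)
pose f (v : 'rV[R]_k) := nu v^T.
have fB u v : `|f u - f v| <= B * (k * 1)%:R * `|u - v|.
  have hs (x y : 'cV[R]_k) : nu x - nu y <= nu (x - y).
    by rewrite lerBlDr; have := hD (x - y) y; rewrite subrK.
  have hN (x : 'cV[R]_k) : nu (- x) = nu x by rewrite -scaleN1r hZ normrN1 mul1r.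
  have e : nu (u - v)^T <= B * (k * 1)%:R * `|u - v|.
    apply: (le_trans (hB _)); rewrite -mulrA; apply: ler_wpM2l; first exact: ltW.
    have := norm1_le_mx_norm (u - v); rewrite mul1n muln1.
    rewrite (_ : norm1 (u - v)^T = norm1 (u - v))//.
    by rewrite /norm1 exchange_big; apply: eq_bigr => i _; apply: eq_bigr => j _; rewrite mxE.
  rewrite ler_norml; apply/andP; split.
    rewrite lerNl opprB; apply: (le_trans (hs _ _)).
    by rewrite -hN opprB -linearB.
  by apply: (le_trans (hs _ _)); rewrite -linearB.
have fc : continuous f.
  move=> v; apply: (proj2 (@cvgrPdist_lt _ _ _ (nbhs v) (nbhs_filter v) f (f v))) => e e0.
  have D0 : 0 < B * (k * 1)%:R + 1 by rewrite ltr_wpDl// mulr_ge0// ltW.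
  apply/nbhs_ballP; exists (e / (B * (k * 1)%:R + 1)); first by rewrite /= divr_gt0.
  move=> u; rewrite -ball_normE /= => vu; apply: (le_lt_trans (fB _ _)).
  apply: (@le_lt_trans _ _ ((B * (k * 1)%:R + 1) * `|v - u|)).
    by apply: ler_wpM2r => //; rewrite lerDl.
  by rewrite -ltr_pdivlMl// mulrC.
pose S := [set v : 'rV[R]_k | `|v| = 1].
have Sc : compact S.
  apply: bounded_closed_compact.
    by exists 1; split => // M M1 v /= ->; exact: ltW.
  rewrite (_ : S = (fun v : 'rV[R]_k => `|v|) @^-1` [set 1])//.
  apply: preimage_closed; last exact: closed_eq.
  by move=> v _; exact: norm_continuous.
have normalize (x : 'cV[R]_k) : x != 0 -> S (`|x^T|^-1 *: x^T) /\ nu x = `|x^T| * f (`|x^T|^-1 *: x^T).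
  move=> x0; have n0 : `|x^T| != 0 by rewrite normr_eq0 trmx_eq0.
  rewrite /S /= normrZ normrV ?unitfE// normr_id mulVf//; split => //.
  by rewrite /f linearZ /= trmxK hZ normrV ?unitfE// normr_id mulrA mulfV// mul1r.
(* The sphere is empty exactly when every vector is 0, and then any positive constant will do. *)
have [S0|/set0P/negP/negPn/eqP S0] := pselect (S !=set0); last first.
  exists 1 => // x; have [->|/normalize[Sx]] := eqVneq x 0; first by rewrite norm1_0 mul1r.
  by rewrite S0 in Sx.
have [v Sv vmin] := EVT_min_rV S0 Sc (fun v => continuous_subspaceT fc (x := v)).
have fv0 : 0 < f v.
  rewrite lt_neqAle h0 andbT eq_sym; apply/negP => /eqP /hd /eqP.
  by rewrite trmx_eq0 => /eqP v0; move: Sv; rewrite inE /S /= v0 normr0 => /eqP; rewrite eq_sym oner_eq0.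
exists ((k * 1)%:R / f v + 1); first by rewrite ltr_wpDl// divr_ge0// ltW.
move=> x; have [->|x0] := eqVneq x 0; first by rewrite norm1_0 mulr_ge0// addr_ge0// divr_ge0// ltW.
have [Sx ->] := normalize _ x0.
have hx := vmin _ (mem_set Sx).
apply: (le_trans (norm1_le_mx_norm x)).
have -> : `|x| = `|x^T|.
  apply/eqP; rewrite eq_le; apply/andP; split; rewrite [leLHS]/Num.norm /= mx_normrE;
    apply/bigmax_leP; split => // -[i j] _ /=; rewrite [leRHS]/Num.norm /= mx_normrE;
    apply/bigmax_geP; right; exists (j, i) => //=; by rewrite mxE.
set q := f (`|x^T|^-1 *: x^T) in hx *; rewrite mulrDl mul1r.
apply: ler_wpDr; first by rewrite mulr_ge0// h0.
rewrite [leRHS](_ : _ = (k * 1)%:R * `|x^T| * (q / f v)); last by ring.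
by rewrite ler_peMr// ler_pdivlMr// mul1r.
Qed.

End NormEquivalence.

(** * Lebesgue integrals over segments *)

Lemma Rintegral_sum d (T : measurableType d) (R : realType) (mu : {measure set T -> \bar R})
    (D : set T) I (r : seq I) (f : I -> T -> R) :
  measurable D -> (forall i, mu.-integrable D (EFin \o f i)) ->
  mu.-integrable D (EFin \o (fun s => \sum_(i <- r) f i s)) /\
  Rintegral mu D (fun s => \sum_(i <- r) f i s) = \sum_(i <- r) Rintegral mu D (f i).
Proof.
move=> mD fi; elim: r => [|i r [ih1 ih2]].
  split; first by under eq_fun do rewrite big_nil; exact: integrable0.
  rewrite big_nil -[RHS](mul0r (fine (mu D))) -Rintegral_cst//.
  by apply: eq_Rintegral => s _; rewrite big_nil.
have e : (fun s => \sum_(j <- i :: r) f j s) = (fun s => f i s + \sum_(j <- r) f j s).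
  by apply/funext => s; rewrite big_cons.
rewrite e big_cons -ih2; split; last exact: RintegralD.
exact: (integrableD mD (fi i) ih1).
Qed.

Section Integrals.
Variable R : realType.
Notation mu := (@lebesgue_measure R).

Lemma bounded_integrable (D : set R) (f : R -> R) B :
  measurable D -> (mu D < +oo)%E -> measurable_fun D f ->
  (forall s, D s -> `|f s| <= B) -> mu.-integrable D (EFin \o f).
Proof.
move=> mD Dfin mf fB; apply: measurable_bounded_integrable => //.
exists B; split; first exact: num_real.
by move=> M BM s Ds; exact: le_trans (fB s Ds) (ltW BM).
Qed.

Lemma lebesgue_measure_segment (a b : R) : a <= b -> mu `[a, b] = (b - a)%:E.
Proof.
move=> ab; rewrite lebesgue_measure_itv /= lte_fin.
move: ab; rewrite le_eqVlt => /orP[/eqP->|->]; last by rewrite EFinB.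
by rewrite ltxx subrr.
Qed.

Lemma segment_integrable (a b : R) (f : R -> R) B :
  a <= b -> measurable_fun `[a, b] f ->
  (forall s, a <= s <= b -> `|f s| <= B) -> mu.-integrable `[a, b] (EFin \o f).
Proof.
move=> ab mf fB; apply: (@bounded_integrable _ _ B) => //=.
- by have := lebesgue_measure_segment ab => /= ->; rewrite ltry.
Qed.

Lemma Rintegral_segment_cst (a b c : R) : a <= b ->
  Rintegral mu `[a, b] (fun=> c) = (b - a) * c.
Proof.
move=> ab; rewrite Rintegral_cst//.
by have := lebesgue_measure_segment ab => /= ->; rewrite /= mulrC.
Qed.

Lemma norm_Rintegral_segment_le (a b : R) (f : R -> R) c :
  a <= b -> measurable_fun `[a, b] f ->
  (forall s, a <= s <= b -> `|f s| <= c) -> `|Rintegral mu `[a, b] f| <= (b - a) * c.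
Proof.
move=> ab mf fc; have fi := segment_integrable ab mf fc.
apply: (le_trans (le_normr_Rintegral _ fi)) => //.
rewrite -(Rintegral_segment_cst c ab); apply: le_Rintegral => //.
- exact: (integrable_norm fi).
- exact: (@segment_integrable _ _ _ `|c|).
Qed.

Lemma Rintegral_segment_split (a b c : R) (f : R -> R) B :
  a <= b -> b <= c -> measurable_fun `[a, c] f ->
  (forall s, a <= s <= c -> `|f s| <= B) ->
  Rintegral mu `[a, c] f = Rintegral mu `[a, b] f + Rintegral mu `[b, c] f.
Proof.
move=> ab bc mf fB.
have fi := segment_integrable (le_trans ab bc) mf fB.
have /= := @Rintegral_itvB _ f (BLeft a) (BRight c) b fi.
rewrite !bnd_simp => /(_ ab bc) h.
have fi2 : mu.-integrable `]b, c] (EFin \o f).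
  apply: integrableS fi => //.
  by move=> s /=; rewrite !in_itv /= => /andP[h1 h2]; rewrite h2 (le_trans ab (ltW h1)).
by rewrite -(Rintegral_itv_obnd_cbnd fi2) -h addrC subrK.
Qed.

Lemma Rintegral_exprn (t : R) j : 0 < t ->
  Rintegral mu `[0, t] (fun s => s ^+ j) = t ^+ j.+1 / j.+1%:R.
Proof.
move=> t0; have c0 (f : R -> R) : continuous f -> {within `[0, t], continuous f}.
  by move=> cf; exact: continuous_subspaceT.
have cF : continuous (fun s : R => s ^+ j.+1 / j.+1%:R).
  by move=> s; apply: cvgMl; exact: exprn_continuous.
rewrite /Rintegral (@continuous_FTC2 _ _ (fun s => s ^+ j.+1 / j.+1%:R))//=.
- by rewrite expr0n /= mul0r subr0.
- by apply: c0; exact: exprn_continuous.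
- split => //.
  + by move=> s _; apply: derivableM => //; exact: exprn_derivable.
  + by apply: cvg_at_right_filter; exact: cF.
  + by apply: cvg_at_left_filter; exact: cF.
- move=> s _; rewrite derive1Mr//; last exact: exprn_derivable.
  by rewrite derive1E exp_derive// scaler1 /= mulrAC mulfV// mul1r.
Qed.

End Integrals.

(** * The mean of a measurable function with values in a convex set *)

Section Mean.
Variables (R : realType) (n : nat).
Notation mu := (@lebesgue_measure R).
Implicit Types (x y u v : 'cV[R]_n) (U : set 'cV[R]_n).

Definition convex_set U :=
  forall u v (l : R), U u -> U v -> 0 <= l <= 1 -> U (u + l *: (v - u)).

(** The projection argument needs an inner product, from which [norm1] does not arise in general;
    the next two facts pass between the two norms. *)
Let dot x y := \sum_i x i 0 * y i 0.

Let norm1_dot x (e : R) : 0 <= e -> dot x x <= e ^+ 2 -> norm1 x <= n%:R * e.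
Proof.
move=> e0 h; rewrite /norm1 -[n in n%:R]card_ord -sumr_const mulr_suml.
apply: ler_sum => i _; rewrite big_ord1 mul1r.
rewrite -(@ler_pXn2r _ 2)// ?nnegrE// real_normK ?num_real//.
apply: le_trans h; rewrite /dot (bigD1 i)//= -expr2 lerDl.
by apply: sumr_ge0 => j _; rewrite -expr2 sqr_ge0.
Qed.

Let dot_norm1 x B : norm1 x <= B -> dot x x <= B ^+ 2.
Proof.
move=> xB; have B0 : 0 <= B := le_trans (norm1_ge0 x) xB.
apply: (@le_trans _ _ (\sum_i `|x i 0| * B)).
  apply: ler_sum => i _; apply: le_trans (ler_norm _) _; rewrite normrM.
  by apply: ler_wpM2l => //; exact: le_trans (norm1_entry _ _ _) xB.
rewrite -mulr_suml expr2; apply: ler_wpM2r => //; apply: le_trans xB.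
by rewrite (_ : norm1 x = \sum_i `|x i 0|)//; apply: eq_bigr => i _; rewrite big_ord1.
Qed.

(* The point of U almost closest to the mean m satisfies an approximate obtuse angle
   condition against every w s; integrating it in s bounds the distance to m. *)
Lemma mean_near_convex (U : set 'cV[R]_n) B (t h : R) (w : R -> 'cV[R]_n) e :
  convex_set U -> (forall u, U u -> norm1 u <= B) -> 0 < h -> 0 < e ->
  (forall i, measurable_fun `[t, t + h] (fun s => w s i 0)) ->
  (forall s, t <= s <= t + h -> U (w s)) ->
  exists2 u, U u &
    norm1 (h^-1 *: (\col_i Rintegral mu `[t, t + h] (fun s => w s i 0)) - u) <= e.
Proof.
move=> cU UB h0 e0 mw Uw.
have th : t <= t + h by rewrite lerDl ltW.
set m := h^-1 *: _.
have B0 : 0 <= B.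
  by apply: le_trans (norm1_ge0 _) (UB _ (Uw t _)); rewrite lexx.
(* Returning to [norm1] costs a factor n; dividing by n + 1 also covers n = 0. *)
pose d := e / n.+1%:R; have d0 : 0 < d by rewrite divr_gt0.
pose K := (B + B) ^+ 2; have K0 : 0 <= K by exact: sqr_ge0.
(* K bounds the squared diameter of U, and l is the length of a trial move inside U, small enough
   that l K <= d^2. *)
pose l := Num.min 1 (d ^+ 2 / (K + 1)).
have d20 : 0 < d ^+ 2 by rewrite exprn_gt0.
have K1 : 0 < K + 1 by rewrite ltr_wpDl.
have l0 : 0 < l by rewrite lt_min ltr01 divr_gt0.
have l1 : l <= 1 by rewrite ge_min lexx.
have lK : l * K <= d ^+ 2.
  apply: (@le_trans _ _ (l * (K + 1))); first by rewrite ler_wpM2l ?lerDl// ltW.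
  by rewrite -ler_pdivlMr// ge_min lexx orbT.
pose S := [set dot (m - u) (m - u) | u in U].
have hS : has_inf S.
  split; first by exists (dot (m - w t) (m - w t)), (w t) => //; apply: Uw; rewrite lexx.
  exists 0 => _ [u _ <-]; apply: sumr_ge0 => i _; rewrite -expr2; exact: sqr_ge0.
(* U is not assumed closed, so the distance to m need not be attained; u misses the infimum of the
   squared distances by less than l d^2. *)
have [_ [u Uu <-] uinf] := inf_adherent (mulr_gt0 l0 d20) hS.
exists u => //; set x := m - u in uinf *.
(* Moving from u towards v by the fraction l stays in U, hence lowers the squared distance to m by
   less than l d^2; expanding the square gives the claim. Division by l and l K <= d^2 then give
   [dw]. *)
have key v : U v -> 2 * l * dot x (v - u) <= l ^+ 2 * K + l * d ^+ 2.
  move=> Uv; have l01 : 0 <= l <= 1 by rewrite ltW.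
  have : inf S <= dot (m - (u + l *: (v - u))) (m - (u + l *: (v - u))).
    by apply: ge_inf; [exact: hS.2|exists (u + l *: (v - u)) => //; exact: cU].
  have zK : dot (v - u) (v - u) <= K.
    by apply: dot_norm1; apply: (le_trans (norm1D _ _)); rewrite norm1N lerD// UB.
  have -> : dot (m - (u + l *: (v - u))) (m - (u + l *: (v - u))) =
      dot x x - 2 * l * dot x (v - u) + l ^+ 2 * dot (v - u) (v - u).
    rewrite /dot !mulr_sumr -sumrB -big_split; apply: eq_bigr => i _ /=.
    by rewrite /x !mxE; ring.
  have : l ^+ 2 * dot (v - u) (v - u) <= l ^+ 2 * K by rewrite ler_wpM2l ?sqr_ge0.
  by move=> *; lra.
have dw s : t <= s <= t + h -> dot x (w s) <= dot x u + d ^+ 2.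
  move=> /Uw /key; have -> : dot x (w s - u) = dot x (w s) - dot x u.
    by rewrite /dot -sumrB; apply: eq_bigr => i _; rewrite !mxE mulrBr.
  have : l * (l * K) <= l * d ^+ 2 by rewrite ler_wpM2l// ltW.
  rewrite mulrA -expr2 => q1 q2; rewrite -lerBlDl -(ler_pM2l l0).
  by move: q1 q2; set D := dot x _; set D' := dot x u; move=> q1 q2; lra.
have wi i : mu.-integrable `[t, t + h] (EFin \o (fun s => w s i 0)).
  apply: (@segment_integrable _ _ _ _ B) => // s /Uw/UB.
  by apply: le_trans; exact: norm1_entry.
have xwi i : mu.-integrable `[t, t + h] (EFin \o (fun s => x i 0 * w s i 0)).
  apply: (@segment_integrable _ _ _ _ (`|x i 0| * B)) => //.
    by apply: measurable_funM => //; exact: measurable_cst.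
  move=> s /Uw/UB sB; rewrite normrM ler_wpM2l//.
  by apply: le_trans sB; exact: norm1_entry.
have [Ii IE] := @Rintegral_sum _ _ R mu `[t, t + h] _ (index_enum 'I_n)
  (fun i s => x i 0 * w s i 0) (measurable_itv _) xwi.
have xm : dot x m * h <= h * (dot x u + d ^+ 2).
  have -> : dot x m * h = Rintegral mu `[t, t + h] (fun s => dot x (w s)).
    rewrite IE /dot mulr_suml; apply: eq_bigr => i _.
    rewrite RintegralZl// /m !mxE; field.
    by rewrite gt_eqF.
  have -> : h * (dot x u + d ^+ 2) = Rintegral mu `[t, t + h] (fun=> dot x u + d ^+ 2).
    by rewrite Rintegral_segment_cst// addrAC subrr add0r.
  apply: le_Rintegral => //.
  exact: (@segment_integrable _ _ _ _ `|dot x u + d ^+ 2|).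
(* Since x = m - u, the integrated inequality [xm] bounds the square of x itself. *)
have xx : dot x x <= d ^+ 2.
  have {1}-> : dot x x = dot x m - dot x u.
    by rewrite /dot -sumrB; apply: eq_bigr => i _; rewrite /x !mxE mulrBr.
  by rewrite lerBlDl -(ler_pM2r h0) mulrC [leRHS]mulrC mulrC.
apply: (le_trans (norm1_dot (ltW d0) xx)).
rewrite /d mulrCA ler_piMr ?(ltW e0)// ler_pdivrMr// mul1r ler_nat.
exact: leqnSn.
Qed.

End Mean.

(** * Forced reachable sets and the integral of the exponential *)

Section Reachable.
Variables (R : realType) (n : nat) (A : 'M[R]_n).
Notation mu := (@lebesgue_measure R).
Let a := norm1 A.
Let a0 : 0 <= a. Proof. exact: norm1_ge0. Qed.
Local Notation E t := (expm (t *: A)).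

Lemma measurable_Lpoly k i j : measurable_fun setT (fun s : R => Lpoly A s k i j).
Proof.
rewrite (_ : (fun s : R => _) = fun s : R => \sum_(l < k) s ^+ l * (l`!%:R^-1 * (A ^+ l) i j)).
  apply: measurable_sum => l; apply: measurable_funM; last exact: measurable_cst.
  exact: measurable_funX.
by apply/funext => s; rewrite LpolyE summxE; apply: eq_bigr => l _; rewrite mxE mulrA.
Qed.

Lemma measurable_expm i j : measurable_fun setT (fun s : R => E s i j).
Proof.
apply: (measurable_fun_cvg (h := fun m s => Lpoly A s m i j)).
  by move=> m; exact: measurable_Lpoly.
move=> s _; have := @coord_continuous R n n i j (E s).
exact: cvg_trans (cvg_app (fun M : 'M[R]_n => M i j) (@expm_cvg R n A s)).
Qed.

Lemma measurable_expm_mul (D : set R) (w : R -> 'cV[R]_n) i : measurable D ->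
  (forall k, measurable_fun D (fun s => w s k 0)) ->
  measurable_fun D (fun s => (E s *m w s) i 0).
Proof.
move=> mD mw; under eq_fun do rewrite mxE.
apply: measurable_sum => k; apply: measurable_funM; last exact: mw.
by apply: measurable_funTS; exact: measurable_expm.
Qed.

Lemma expm_mul_bound (T B s : R) (w : 'cV[R]_n) : 0 <= s <= T -> norm1 w <= B ->
  norm1 (E s *m w) <= expR (T * a) * B.
Proof.
move=> /andP[s0 sT] wB; apply: (le_trans (norm1_expm_mul _ _ s0)).
by apply: ler_pM; rewrite ?expR_ge0 ?norm1_ge0// ler_expR ler_wpM2r.
Qed.

Definition expm_integral (w : R -> 'cV[R]_n) (D : set R) : 'cV[R]_n :=
  \col_i Rintegral mu D (fun s => (E s *m w s) i 0).

Definition lip_const (T : R) := (a + T * a ^+ 2) * expR (T * a).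

Lemma lip_const_ge0 (T : R) : 0 <= T -> 0 <= lip_const T.
Proof. by move=> T0; rewrite mulr_ge0 ?expR_ge0// addr_ge0// mulr_ge0// sqr_ge0. Qed.

(** Replacing E(s) by E(t) changes each coordinate of the integrand by at most h times the Lipschitz
    bound; integration over length h gives the second h, and n counts the coordinates. *)
Lemma expm_integral_freeze (T B t h : R) (w : R -> 'cV[R]_n) :
  0 <= t -> 0 <= h -> t + h <= T ->
  (forall k, measurable_fun `[t, t + h] (fun s => w s k 0)) ->
  (forall s, t <= s <= t + h -> norm1 (w s) <= B) ->
  norm1 (expm_integral w `[t, t + h] -
         E t *m \col_k Rintegral mu `[t, t + h] (fun s => w s k 0)) <=
    n%:R * (h * (h * lip_const T * B)).
Proof.
move=> t0 h0 tT mw wB; have th : t <= t + h by rewrite lerDl.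
have T0 : 0 <= T := le_trans (addr_ge0 t0 h0) tT.
have L0 := lip_const_ge0 T0.
have sub s : t <= s <= t + h -> 0 <= s <= T.
  by move=> /andP[s1 s2]; rewrite (le_trans t0 s1) (le_trans s2 tT).
rewrite /norm1 -[n in n%:R]card_ord -sumr_const mulr_suml; apply: ler_sum => i _.
rewrite big_ord1 mul1r !mxE.
have wi k : mu.-integrable `[t, t + h] (EFin \o (fun s => w s k 0)).
  apply: (@segment_integrable _ _ _ _ B) => // s /wB.
  by apply: le_trans; exact: norm1_entry.
have Ewi k : mu.-integrable `[t, t + h] (EFin \o (fun s => E t i k * w s k 0)).
  apply: (@segment_integrable _ _ _ _ (`|E t i k| * B)) => //.
    by apply: measurable_funM => //; exact: measurable_cst.
  move=> s /wB sB; rewrite normrM ler_wpM2l//.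
  by apply: le_trans sB; exact: norm1_entry.
have [Ii IE] := @Rintegral_sum _ _ R mu `[t, t + h] _ (index_enum 'I_n)
  (fun k s => E t i k * w s k 0) (measurable_itv _) Ewi.
have -> : \sum_j E t i j * (\col_k Rintegral mu `[t, t + h] (fun s => w s k 0)) j 0 =
   Rintegral mu `[t, t + h] (fun s => (E t *m w s) i 0).
  rewrite (@eq_Rintegral _ _ R mu _ (fun s => \sum_k E t i k * w s k 0)); last first.
    by move=> s _; rewrite mxE.
  by rewrite IE; apply: eq_bigr => k _; rewrite mxE RintegralZl.
have mE := measurable_expm_mul i (measurable_itv _) mw.
have mEt : measurable_fun `[t, t + h] (fun s => (E t *m w s) i 0).
  rewrite (_ : (fun s => _) = (fun s => \sum_k E t i k * w s k 0)); last first.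
    by apply/funext => s; rewrite mxE.
  by apply: measurable_sum => k; apply: measurable_funM => //; exact: measurable_cst.
have b1 s : t <= s <= t + h -> `|(E s *m w s) i 0| <= expR (T * a) * B.
  move=> st; apply: (le_trans (norm1_entry _ _ _)).
  by apply: expm_mul_bound; [exact: sub|exact: wB].
have b2 s : t <= s <= t + h -> `|(E t *m w s) i 0| <= expR (T * a) * B.
  move=> st; apply: (le_trans (norm1_entry _ _ _)).
  apply: expm_mul_bound; last exact: wB.
  by apply: sub; rewrite lexx.
rewrite -RintegralB//; last 2 first.
- exact: (segment_integrable th mE b1).
- exact: (segment_integrable th mEt b2).
rewrite -[X in X * (h * _ * _)](_ : t + h - t = h); last by rewrite addrAC subrr add0r.
apply: norm_Rintegral_segment_le => //; first exact: measurable_funB.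
move=> s st; have /andP[s1 s2] := st.
have -> : (E s *m w s) i 0 - (E t *m w s) i 0 = (E s *m w s - E t *m w s) i 0.
  by rewrite [RHS]mxE [X in _ = _ + X]mxE.
apply: (le_trans (norm1_entry _ _ _)).
have := @expm_lipschitz R n A T t (s - t) 1 (w s) t0.
rewrite subr_ge0 addrC subrK => /(_ s1 (le_trans s2 tT)).
move=> q; apply: (le_trans q); rewrite -/a -/(lip_const T).
have st' : s - t <= h by rewrite lerBlDl.
apply: ler_pM; [|exact: norm1_ge0|exact: ler_wpM2r|exact: wB].
by apply: mulr_ge0; rewrite ?subr_ge0.
Qed.

Section Input.
Variables (U : set 'cV[R]_n) (B T : R).
Hypotheses (cU : convex_set U) (UB : forall u, U u -> norm1 u <= B) (T0 : 0 < T) (B0 : 0 <= B).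

(** The first term is the cost of freezing the exponential; the second pays for the tolerance h with
    which the mean of the input is approximated by a point of U. *)
Definition reach_const := n%:R * (lip_const T * B) + expR (T * a).

Lemma reach_const_ge0 : 0 <= reach_const.
Proof.
by rewrite addr_ge0 ?expR_ge0// mulr_ge0// (mulr_ge0 (lip_const_ge0 (ltW T0))).
Qed.

Lemma expm_integral_split (t h : R) (w : R -> 'cV[R]_n) : 0 <= t -> 0 <= h -> t + h <= T ->
  (forall k, measurable_fun `[0, t + h] (fun s => w s k 0)) ->
  (forall s, 0 <= s <= t + h -> U (w s)) ->
  expm_integral w `[0, t + h] = expm_integral w `[0, t] + expm_integral w `[t, t + h].
Proof.
move=> t0 h0 tT mw Uw; apply/colP => i; rewrite !mxE.
apply: (@Rintegral_segment_split _ _ _ _ _ (expR (T * a) * B)) => //.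
- by rewrite lerDl.
- exact: measurable_expm_mul.
- move=> s st; apply: (le_trans (norm1_entry _ _ _)).
  apply: expm_mul_bound; last by apply: UB; exact: Uw.
  by case/andP: st => s1 s2; rewrite s1 (le_trans s2).
Qed.

Lemma Ru_zero y : Ru A U 0 y -> y = 0.
Proof.
move=> [w [_ _ ->]]; apply/colP => i; rewrite !mxE.
by rewrite set_itv1 Rintegral_set1.
Qed.

Lemma Ru_zero_mem u : U u -> Ru A U 0 0.
Proof.
move=> Uu; exists (fun=> u); split => //.
by apply/colP => i; rewrite !mxE set_itv1 Rintegral_set1.
Qed.

(** The witness follows the input of y' up to time t and then holds u constant. *)
Lemma Ru_extend (t h : R) y' u : 0 <= t -> 0 <= h -> t + h <= T ->
  Ru A U t y' -> U u ->
  exists2 y, Ru A U (t + h) y &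
    norm1 (y - (y' + h *: (E t *m u))) <= reach_const * h ^+ 2.
Proof.
move=> t0 h0 tT [w' [Uw' mw' ->]] Uu; have th : t <= t + h by rewrite lerDl.
pose w s := if s <= t then w' s else u.
have mw k : measurable_fun `[0, t + h] (fun s => w s k 0).
  rewrite (_ : (fun s => _) = (fun s => if s <= t then w' s k 0 else u k 0)); last first.
    by apply/funext => s; rewrite /w; case: ifP.
  apply: measurable_fun_if => //.
  - apply: (measurable_fun_ler (g := cst t)) => //; exact: measurable_cst.
  - apply: measurable_funS (mw' k) => // s /= [].
    by rewrite !in_itv /= => /andP[-> _] ->.
have Uw s : 0 <= s <= t + h -> U (w s).
  move=> /andP[s0 _]; rewrite /w; case: ifP => // st.
  by apply: Uw'; rewrite s0.
exists (expm_integral w `[0, t + h]); first by exists w; split.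
rewrite (expm_integral_split t0 h0 tT mw Uw).
have -> : expm_integral w `[0, t] = \col_i Rintegral mu `[0, t] (fun s => (E s *m w' s) i 0).
  apply/colP => i; rewrite !mxE; apply: eq_Rintegral => s.
  by rewrite inE /= in_itv /= /w => /andP[_ ->].
have mw2 k : measurable_fun `[t, t + h] (fun s => w s k 0).
  apply: measurable_funS (mw k) => // s /=.
  by rewrite !in_itv /= => /andP[ts ->]; rewrite (le_trans t0 ts).
have wB s : t <= s <= t + h -> norm1 (w s) <= B.
  by move=> /andP[s1 s2]; apply/UB/Uw; rewrite (le_trans t0 s1).
have := expm_integral_freeze t0 h0 tT mw2 wB.
have -> : \col_k Rintegral mu `[t, t + h] (fun s => w s k 0) = h *: u.
  apply/colP => k; rewrite !mxE.
  (* At s = t the input still has its old value, so it equals u only on the half-open interval,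
     which has the same integral. *)
  have wi : mu.-integrable `]t, t + h] (EFin \o (fun s => w s k 0)).
    apply: integrableS (segment_integrable (B := B) th (mw2 k) _) => //.
      by move=> s /=; rewrite !in_itv /= => /andP[s1 ->]; rewrite ltW.
    by move=> s /wB; apply: le_trans; exact: norm1_entry.
  rewrite -(Rintegral_itv_obnd_cbnd wi) (@eq_Rintegral _ _ R mu _ (fun=> u k 0)); last first.
    by move=> s; rewrite inE /= in_itv /= => /andP[ts _]; rewrite /w leNgt ts.
  rewrite (Rintegral_itv_obnd_cbnd (f := fun=> u k 0)); last first.
    apply: integrableS (segment_integrable (B := `|u k 0|) th (measurable_cst _) _) => //.
    by move=> s /=; rewrite !in_itv /= => /andP[s1 ->]; rewrite ltW.
  by rewrite Rintegral_segment_cst// addrAC subrr add0r.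
rewrite -scalemxAr => q; rewrite opprD addrACA subrr add0r; apply: (le_trans q).
rewrite /reach_const mulrDl [leLHS](_ : _ = n%:R * (lip_const T * B) * h ^+ 2); last by ring.
by rewrite lerDl mulr_ge0 ?expR_ge0 ?sqr_ge0.
Qed.

Lemma Ru_restrict (t h : R) y : 0 <= t -> 0 < h -> t + h <= T ->
  Ru A U (t + h) y ->
  exists y' u, [/\ Ru A U t y', U u &
    norm1 (y - (y' + h *: (E t *m u))) <= reach_const * h ^+ 2].
Proof.
move=> t0 h0 tT [w [Uw mw ->]]; have th : t <= t + h by rewrite lerDl ltW.
have h0' := ltW h0.
have tT' : t <= T := le_trans th tT.
have mw2 k : measurable_fun `[t, t + h] (fun s => w s k 0).
  apply: measurable_funS (mw k) => // s /=.
  by rewrite !in_itv /= => /andP[ts ->]; rewrite (le_trans t0 ts).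
have Uw2 s : t <= s <= t + h -> U (w s).
  by move=> /andP[s1 s2]; apply/Uw; rewrite (le_trans t0 s1).
have wB s : t <= s <= t + h -> norm1 (w s) <= B by move=> /Uw2; exact: UB.
(* The tolerance is h itself: multiplied by the length h of the interval it becomes an error of
   order h^2. *)
have [u Uu um] := mean_near_convex cU UB h0 h0 mw2 Uw2.
exists (expm_integral w `[0, t]), u; split => //.
  exists w; split => [s /andP[s0 st]|i|//]; first by apply: Uw; rewrite s0 (le_trans st).
  apply: measurable_funS (mw i) => // s /=.
  by rewrite !in_itv /= => /andP[-> st]; rewrite (le_trans st).
rewrite -/(expm_integral w `[0, t + h]) (expm_integral_split t0 h0' tT mw Uw).
rewrite opprD addrACA subrr add0r.
have q := expm_integral_freeze t0 h0' tT mw2 wB.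
apply: (le_trans (norm1_sub _ (E t *m \col_k Rintegral mu `[t, t + h] (fun s => w s k 0)) _)).
rewrite /reach_const mulrDl; apply: lerD.
  by apply: (le_trans q); rewrite [leLHS](_ : _ = n%:R * (lip_const T * B) * h ^+ 2)//; ring.
set W := \col_k _ in um *.
have -> : E t *m W - h *: (E t *m u) = h *: (E t *m (h^-1 *: W - u)).
  by rewrite mulmxBr scalerBr -scalemxAr scalerA mulfV ?scale1r// gt_eqF.
rewrite norm1Z gtr0_norm// expr2 mulrA [expR _ * h]mulrC -mulrA; apply: ler_wpM2l => //.
by apply: expm_mul_bound => //; rewrite t0.
Qed.

Lemma Ru_lipschitz (t h : R) y : 0 <= t -> 0 <= h -> t + h <= T ->
  Ru A U (t + h) y ->
  exists2 y', Ru A U t y' & norm1 (y - y') <= (reach_const * T + expR (T * a) * B) * h.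
Proof.
move=> t0; rewrite le_eqVlt => /orP[/eqP<-|h0] tT.
  by rewrite addr0 => Ry; exists y => //; rewrite subrr norm1_0 mulr0.
move=> /(Ru_restrict t0 h0 tT) [y' [u [Ry' Uu q]]]; exists y' => //.
have hT : h <= T by apply: le_trans tT; rewrite lerDr.
have -> : y - y' = (y - (y' + h *: (E t *m u))) + h *: (E t *m u).
  by rewrite opprD addrA subrK.
apply: (le_trans (norm1D _ _)); rewrite mulrDl; apply: lerD.
  apply: (le_trans q); rewrite expr2 mulrA; apply: ler_wpM2r; first exact: ltW.
  by apply: ler_wpM2l => //; exact: reach_const_ge0.
rewrite norm1Z gtr0_norm// mulrC; apply: ler_wpM2r; first exact: ltW.
apply: expm_mul_bound; last exact: UB.
by rewrite t0 (le_trans _ tT)// lerDl ltW.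
Qed.

End Input.

(** Finite segments of the two tails compare termwise, and the rest of the tail of x tends to 0. *)
Lemma exp_tail_le (x y : R) k : 0 <= x <= y -> exp_tail x k <= exp_tail y k.
Proof.
move=> /andP[x0 xy].
apply: (@le_cvg0_limit _ _ _ (fun m => exp_tail x (m + k))).
  by rewrite (cvg_shiftn k (exp_tail x)); exact: exp_tail_cvg.
move=> m; rewrite -lerBlDr.
have split z : exp_tail z k - exp_tail z (m + k) = \sum_(j < m) z ^+ (k + j) / (k + j)`!%:R.
  rewrite /exp_tail addnC big_split_ord /=; ring.
apply: (@le_trans _ _ (exp_tail y k - exp_tail y (m + k))); last first.
  by rewrite lerBlDr lerDl; apply: exp_tail_ge0; exact: le_trans xy.
rewrite !split; apply: ler_sum => j _; apply: ler_wpM2r => //.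
by rewrite lerXn2r ?nnegrE// (le_trans x0).
Qed.

(** T(t, k) is the integral of L(s, k) over [0, t], so the difference is an integral of exponential
    tails, each at most the tail at t. *)
Lemma mxint_Tpoly_tail (t : R) k : 0 < t ->
  norm1 (mxint t (fun s => E s) - Tpoly A t k) <=
    (n * n)%:R * (t * norm1 (1%:M : 'M[R]_n)) * exp_tail (t * a) k.
Proof.
move=> t0; have t0' := ltW t0.
have ent i j : `|(mxint t (fun s => E s) - Tpoly A t k) i j| <=
    t * (exp_tail (t * a) k * norm1 (1%:M : 'M[R]_n)).
  rewrite !mxE.
  have mL : measurable_fun `[0, t] (fun s : R => Lpoly A s k i j).
    by apply: measurable_funTS; exact: measurable_Lpoly.
  have mE : measurable_fun `[0, t] (fun s : R => E s i j).
    by apply: measurable_funTS; exact: measurable_expm.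
  have bnd (M : 'M[R]_n) c : norm1 (M *m 1%:M) <= c -> `|M i j| <= c.
    by rewrite mulmx1; apply: le_trans; exact: norm1_entry.
  have bL s : 0 <= s <= t -> `|Lpoly A s k i j| <= expR (t * a) * norm1 (1%:M : 'M[R]_n).
    move=> /andP[s0 st]; apply: bnd; apply: le_trans (norm1_Lpoly_mul _ _ _ s0) _.
    by rewrite ler_wpM2r ?norm1_ge0// ler_expR ler_wpM2r.
  have bE s : 0 <= s <= t -> `|E s i j| <= expR (t * a) * norm1 (1%:M : 'M[R]_n).
    move=> /andP[s0 st]; apply: bnd; apply: le_trans (norm1_expm_mul _ _ s0) _.
    by rewrite ler_wpM2r ?norm1_ge0// ler_expR ler_wpM2r.
  have -> : Tpoly A t k i j = Rintegral mu `[0, t] (fun s => Lpoly A s k i j).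
    pose f (l : 'I_k) s := (l`!%:R^-1 * (A ^+ l) i j) * s ^+ l.
    have mX (l : 'I_k) : mu.-integrable `[0, t] (EFin \o (fun s : R => s ^+ l)).
      apply: (@segment_integrable _ _ _ _ (t ^+ l)) => //.
      by move=> s /andP[s0 st]; rewrite ger0_norm ?exprn_ge0// lerXn2r ?nnegrE.
    have fi l : mu.-integrable `[0, t] (EFin \o f l).
      apply: (@segment_integrable _ _ _ _ (`|l`!%:R^-1 * (A ^+ l) i j| * t ^+ l)) => //.
        apply: measurable_funM; first exact: measurable_cst.
        by apply: measurable_funX; exact: measurable_id.
      move=> s /andP[s0 st]; rewrite normrM ler_wpM2l//.
      by rewrite ger0_norm ?exprn_ge0// lerXn2r ?nnegrE.
    have [_ IE] := @Rintegral_sum _ _ R mu `[0, t] _ (index_enum 'I_k) f (measurable_itv _) fi.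
    rewrite (@eq_Rintegral _ _ R mu _ (fun s => \sum_l f l s)); last first.
      move=> s _; rewrite LpolyE summxE; apply: eq_bigr => l _.
      by rewrite mxE /f; ring.
    rewrite IE summxE; apply: eq_bigr => l _.
    rewrite RintegralZl// Rintegral_exprn// mxE factS natrM invfM; ring.
  rewrite -RintegralB//; last 2 first.
  - exact: (segment_integrable t0' mE bE).
  - exact: (segment_integrable t0' mL bL).
  rewrite -[X in X * (exp_tail _ _ * _)]subr0.
  apply: norm_Rintegral_segment_le => //; first exact: measurable_funB.
  move=> s /andP[s0 st].
  have -> : E s i j - Lpoly A s k i j = (E s - Lpoly A s k) i j.
    by rewrite [RHS]mxE [X in _ = _ + X]mxE.
  apply: bnd; apply: le_trans (expm_tail _ _ _ s0) _.
  apply: ler_wpM2r; first exact: norm1_ge0.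
  by apply: exp_tail_le; rewrite mulr_ge0// ler_wpM2r.
apply: (@le_trans _ _ (\sum_(i < n) \sum_(j < n) t * (exp_tail (t * a) k * norm1 (1%:M : 'M[R]_n)))).
  by apply: ler_sum => i _; apply: ler_sum => j _; exact: ent.
rewrite !sumr_const !card_ord -mulrnA -[leLHS]mulr_natl.
by rewrite [leLHS](_ : _ = (n * n)%:R * (t * norm1 (1%:M : 'M[R]_n)) * exp_tail (t * a) k)//; ring.
Qed.

(** T(t, k) converges to an invertible integral, and invertibility survives small perturbations by
    [unitmx_near]. This makes [eta] well defined. *)
Lemma Tpoly_unit (t : R) : 0 < t -> Iset A t ->
  exists K, forall k, (K <= k)%N -> Tpoly A t k \in unitmx.
Proof.
move=> t0 [_ Iu]; set M := mxint _ _ in Iu.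
pose C := norm1 (invmx M) * ((n * n)%:R * (t * norm1 (1%:M : 'M[R]_n))).
have C0 : 0 <= C by rewrite !mulr_ge0 ?norm1_ge0// ltW.
have C1 : 0 < C + 1 by rewrite ltr_wpDl.
have /cvgr0Pnorm_lt/(_ (C + 1)^-1) := exp_tail_cvg (t * a).
rewrite invr_gt0 => /(_ C1)[K _ hK]; exists K => k /hK /=.
rewrite ger0_norm ?exp_tail_ge0 ?mulr_ge0 ?(ltW t0)// => h.
apply: (unitmx_near Iu).
apply: (@le_lt_trans _ _ (C * exp_tail (t * a) k)).
  by rewrite /C -mulrA; apply: ler_wpM2l; [exact: norm1_ge0|exact: mxint_Tpoly_tail].
apply: (@le_lt_trans _ _ (C * (C + 1)^-1)); first by rewrite ler_wpM2l// ltW.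
by rewrite ltr_pdivrMr// mul1r ltrDl.
Qed.

Lemma Irep_spec (nu : vnorms R) (hnu : forall k, is_norm (@nu k)) p (t eps : R)
    (cG : 'cV[R]_n * 'M[R]_(n, p)) : 0 < t -> Iset A t -> 0 <= eps < 1 ->
  exists k l, [/\ Tpoly A t k \in unitmx, eps < l <= 1 &
    Irep nu A t eps cG = (Tpoly A t k *m cG.1, l *: (Tpoly A t k *m cG.2))].
Proof.
move=> t0 It e01; set k := Defs.eta nu A t cG.1 cG.2 eps.
exists k, (lam nu A t cG.1 cG.2 k).
have [k1 k2] : eps < lam nu A t cG.1 cG.2 k /\ Tpoly A t k \in unitmx.
  apply: (natminP (P := fun k => eps < lam nu A t cG.1 cG.2 k /\ Tpoly A t k \in unitmx)).
  have [K hK] := lam_gt hnu A cG.1 cG.2 (ltW t0) e01.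
  have [K' hK'] := Tpoly_unit t0 It.
  by exists (maxn K K'); split; [apply: hK; exact: leq_maxl|apply: hK'; exact: leq_maxr].
by split => //; rewrite k1 lam_le1// ltW.
Qed.

End Reachable.

(** * Hausdorff distance and sets given by center and generators *)

Section Hausdorff.
Variables (R : realType) (n : nat).
Implicit Types X Y : set 'cV[R]_n.

(** One half of the Hausdorff distance, measured in [norm1] so that the error analysis runs in a
    single norm; [hausdorff_le] converts to [nu] at the end. *)
Definition within_dist (K : R) X Y := forall x, X x -> exists2 y, Y y & norm1 (x - y) <= K.

Lemma within_dist_le K K' X Y : K <= K' -> within_dist K X Y -> within_dist K' X Y.
Proof. by move=> KK XY x /XY[y Yy xy]; exists y => //; exact: le_trans KK. Qed.

Lemma within_dist_msum K K' X X' Y Y' : within_dist K X Y -> within_dist K' X' Y' ->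
  within_dist (K + K') (Defs.msum X X') (Defs.msum Y Y').
Proof.
move=> XY XY' _ [x [x' [/XY[y Yy xy] /XY'[y' Yy' xy'] ->]]].
exists (y + y'); first by exists y, y'.
by rewrite opprD addrACA; apply: le_trans (norm1D _ _) (lerD xy xy').
Qed.

(** The radius e is kept apart from C K because admissible radii are positive, while C K may be
    0. *)
Lemma hausdorff_le (nu : vnorms R) (hnu : forall k, is_norm (@nu k)) (C K e : R) X Y :
  (forall x : 'cV[R]_n, nu n x <= C * norm1 x) -> 0 <= C -> 0 < e -> C * K <= e ->
  within_dist K X Y -> within_dist K Y X -> (hausdorff nu X Y <= e%:E)%E.
Proof.
move=> nuC C0 e0 CK XY YX; have [_ _ hZ _] := hnu n.
have ball x y : norm1 (x - y) <= K -> exists b : 'cV[R]_n, ball1 nu b /\ x = y + e *: b.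
  move=> xy; exists (e^-1 *: (x - y)); split.
    rewrite /ball1 /= hZ gtr0_norm ?invr_gt0// mulrC ler_pdivrMr// mul1r.
    by apply: le_trans (nuC _) _; apply: le_trans CK; exact: ler_wpM2l.
  by rewrite scalerA mulfV ?gt_eqF// scale1r addrC subrK.
apply: ereal_inf_lbound; exists e => //; split => // x.
  by move=> /XY[y Yy /ball[b [bb ->]]]; exists y, (e *: b); split => //; exists b.
by move=> /YX[y Yy /ball[b [bb ->]]]; exists y, (e *: b); split => //; exists b.
Qed.

(** Points with the same parameter b are paired, so closeness of representations yields closeness of
    sets. *)
Lemma zset_dist p (c c' : 'cV[R]_n) (G G' : 'M[R]_(n, p)) (b : 'cV[R]_p) beta :
  norm1 b <= beta ->
  norm1 ((c + G *m b) - (c' + G' *m b)) <= norm1 (c - c') + norm1 (G - G') * beta.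
Proof.
move=> bb; rewrite opprD addrACA -mulmxBl; apply: (le_trans (norm1D _ _)).
rewrite lerD2l; apply: (le_trans (norm1M _ _)).
by apply: ler_wpM2l => //; exact: norm1_ge0.
Qed.

Lemma convex_zset (nu : vnorms R) (hnu : forall k, is_norm (@nu k)) p
  (c : 'cV[R]_n) (G : 'M[R]_(n, p)) : convex_set (zset nu c G).
Proof.
have [h0 _ hZ hD] := hnu p.
move=> _ _ l [b1 hb1 <-] [b2 hb2 <-] /andP[l0 l1].
exists (b1 + l *: (b2 - b1)); last first.
  by rewrite mulmxDr -scalemxAr mulmxBr -addrA; congr (_ + (_ + l *: _)); rewrite opprD addrACA subrr add0r.
move: hb1 hb2; rewrite /ball1 /= => hb1 hb2.
have -> : b1 + l *: (b2 - b1) = (1 - l) *: b1 + l *: b2.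
  by rewrite scalerBr scalerBl scale1r addrA addrAC.
apply: (le_trans (hD _ _)); rewrite !hZ ger0_norm ?subr_ge0// ger0_norm//.
have q1 : (1 - l) * nu p b1 <= 1 - l by rewrite ler_piMr// subr_ge0.
have q2 : l * nu p b2 <= l by rewrite ler_piMr.
by lra.
Qed.

End Hausdorff.

(** * Error bounds for the sequences S_i, V_i and W_i *)

Section Algorithm.
Variables (R : realType) (nu : vnorms R) (hnu : forall k, is_norm (@nu k)).
Variables (n p : nat) (A : 'M[R]_n) (T : R) (N : nat).
Hypotheses (T0 : 0 < T) (N0 : (0 < N)%N).
Let a := norm1 A.
Let tau := T / N%:R.
Let eh := 1 - (N%:R ^+ 2)^-1 : R.
Let eu := 1 - N%:R^-1 : R.
Hypothesis tauI : Iset A tau.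
Local Notation E t := (expm (t *: A)).
Implicit Types (Z : 'cV[R]_n * 'M[R]_(n, p)).

Let a0 : 0 <= a. Proof. exact: norm1_ge0. Qed.
Let NR0 : 0 < N%:R :> R. Proof. by rewrite ltr0n. Qed.
Let tau0 : 0 < tau. Proof. by rewrite divr_gt0. Qed.
Let tauT : tau / T = N%:R^-1. Proof. by rewrite /tau mulrAC mulfV ?mul1r// gt_eqF. Qed.
Let tau_le : tau <= T.
Proof. by rewrite /tau ler_pdivrMr// ler_peMr ?ler1n// ltW. Qed.
Let eh01 : 0 <= eh < 1.
Proof.
rewrite /eh subr_ge0 ltrBlDr ltrDl invr_gt0 exprn_gt0// andbT.
by rewrite invf_le1 ?exprn_gt0// -natrX ler1n expn_gt0 N0.
Qed.
Let eu01 : 0 <= eu < 1.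
Proof.
by rewrite /eu subr_ge0 ltrBlDr ltrDl invr_gt0 NR0 andbT invf_le1// ler1n.
Qed.
Let index_le i : (i <= N)%N -> i%:R * tau <= T.
Proof.
by move=> iN; rewrite /tau mulrA ler_pdivrMr// [leRHS]mulrC ler_pM2r// ler_nat.
Qed.

Lemma iter_Hrep_dist Z Yc YG i : (i <= N)%N ->
  norm1 ((iter i (Hrep nu A tau eh) Z).1 - E (i%:R * tau) *m Yc) <=
    expR (T * a) * (norm1 (Z.1 - Yc) + T * step_const A T * tau * norm1 Yc) /\
  norm1 ((iter i (Hrep nu A tau eh) Z).2 - E (i%:R * tau) *m YG) <=
    expR (T * a) * (norm1 (Z.2 - YG) + T * step_const A T * tau * norm1 YG).
Proof.
move=> iN; have iT := index_le iN.
have bound m (Y W : 'M[R]_(n, m)) (z : R) :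
    z <= expR (i%:R * tau * a) * (norm1 (W - Y) + i%:R * (step_const A T * tau ^+ 2 * norm1 Y)) ->
    z <= expR (T * a) * (norm1 (W - Y) + T * step_const A T * tau * norm1 Y).
  move=> h; apply: (le_trans h); apply: ler_pM; first exact: expR_ge0.
  - rewrite addr_ge0 ?norm1_ge0// mulr_ge0//.
    exact: mulr_ge0 (mulr_ge0 (step_const_ge0 A T) (sqr_ge0 _)) (norm1_ge0 _).
  - by rewrite ler_expR ler_wpM2r.
  (* One of the two factors tau is spent on the number of steps, since i tau <= T. *)
  rewrite lerD2l [leLHS](_ : _ = i%:R * tau * (step_const A T * tau * norm1 Y)); last by ring.
  rewrite [leRHS](_ : _ = T * (step_const A T * tau * norm1 Y)); last by ring.
  apply: ler_wpM2r => //.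
  exact: mulr_ge0 (mulr_ge0 (step_const_ge0 A T) (ltW tau0)) (norm1_ge0 _).
have step j : exists k l, [/\ (2 <= k)%N, eh < l <= 1 &
    iter j.+1 (Hrep nu A tau eh) Z = (Lpoly A tau k *m (iter j (Hrep nu A tau eh) Z).1,
       l *: (Lpoly A tau k *m (iter j (Hrep nu A tau eh) Z).2))].
  by rewrite iterS; exact: Hrep_spec (ltW tau0) eh01.
have ehE : 1 - (tau / T) ^+ 2 = eh by rewrite tauT exprVn.
split; apply: bound.
- apply: (propagation Yc (Z := fun j => (iter j (Hrep nu A tau eh) Z).1) T0 (ltW tau0)) => // j.
  have [k [l [k2 _ ->]]] := step j; exists k, 1; rewrite scale1r; split => //.
    by rewrite ler01 lexx.
  by rewrite ehE ltW//; case/andP: eh01.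
- apply: (propagation YG (Z := fun j => (iter j (Hrep nu A tau eh) Z).2) T0 (ltW tau0)) => // j.
  have [k [l [k2 /andP[el l1] ->]]] := step j; exists k, l; split => //.
    by rewrite l1 andbT; apply: le_trans (ltW el); case/andP: eh01.
  by rewrite ehE ltW.
Qed.

(** T(tau, k) is itself of size tau, so a relative defect of at most 1 - eu = tau / T already gives
    an error of order tau^2. *)
Lemma Irep_dist Z :
  norm1 ((Irep nu A tau eu Z).1 - tau *: Z.1) <=
    tau ^+ 2 * ((a + T^-1) * expR (T * a)) * norm1 Z.1 /\
  norm1 ((Irep nu A tau eu Z).2 - tau *: Z.2) <=
    tau ^+ 2 * ((a + T^-1) * expR (T * a)) * norm1 Z.2.
Proof.
have [k [l [ku /andP[el l1] ->]]] := Irep_spec hnu Z tau0 tauI eu01; rewrite /=.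
have e1 : expR (tau * a) <= expR (T * a) by rewrite ler_expR ler_wpM2r.
have T1 : 0 <= T^-1 by rewrite invr_ge0 ltW.
have first m (Y : 'M[R]_(n, m)) :
    norm1 (Tpoly A tau k *m Y - tau *: Y) <= tau ^+ 2 * (a * expR (T * a)) * norm1 Y.
  have [k0|k0] := posnP k; last first.
    apply: (le_trans (Tpoly_first_order A Y (ltW tau0) k0)).
    rewrite [tau ^+ 2 * (a * _)]mulrA; apply: ler_wpM2r; first exact: norm1_ge0.
    by apply: ler_wpM2l => //; exact: mulr_ge0 (sqr_ge0 _) a0.
  have rhs0 : 0 <= tau ^+ 2 * (a * expR (T * a)) * norm1 Y.
    by rewrite mulr_ge0 ?norm1_ge0// mulr_ge0 ?sqr_ge0// mulr_ge0 ?expR_ge0.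
  (* k = 0 forces n = 0, because Tpoly A tau 0 = 0 *)
  suff n0 : n = 0%N.
    apply: le_trans rhs0; rewrite /norm1 big1// => i _.
    by exfalso; case: i => i; rewrite n0.
  move: ku; rewrite k0 /Tpoly big_ord0; case: (n) => // n'.
  by rewrite -[_ \in _]/(0 \is a GRing.unit) unitr0.
have ex m (Y : 'M[R]_(n, m)) : tau ^+ 2 * ((a + T^-1) * expR (T * a)) * norm1 Y =
   tau ^+ 2 * (a * expR (T * a)) * norm1 Y + (1 - eu) * (tau * expR (T * a) * norm1 Y).
  by have -> : 1 - eu = tau / T; [rewrite tauT /eu opprB addrC subrK|ring].
rewrite !ex; split.
  apply: (le_trans (first _ _)); rewrite lerDl.
  rewrite mulr_ge0 ?subr_ge0//; first by case/andP: eu01 => _ /ltW.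
  by rewrite mulr_ge0 ?norm1_ge0// mulr_ge0 ?expR_ge0// ltW.
have -> : l *: (Tpoly A tau k *m Z.2) - tau *: Z.2 =
   (Tpoly A tau k *m Z.2 - tau *: Z.2) + (l - 1) *: (Tpoly A tau k *m Z.2).
  by move: (Tpoly A tau k *m Z.2) => W; apply/matrixP => i j; rewrite !mxE; ring.
apply: (le_trans (norm1D _ _)); apply: lerD; first exact: first.
rewrite norm1Z; apply: ler_pM => //; first exact: norm1_ge0.
  by rewrite ler_norml; move: el l1 eu01; set z := eu; move=> *; lra.
apply: (le_trans (norm1_Tpoly_mul _ _ _ (ltW tau0))).
by apply: ler_wpM2r; [exact: norm1_ge0|apply: ler_wpM2l => //; exact: ltW].
Qed.

Variable beta : R.
Hypothesis ball_beta : forall b : 'cV[R]_p, ball1 nu b -> norm1 b <= beta.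

Let beta0 : 0 <= beta.
Proof.
by apply: le_trans (ball_beta (b := 0) _); rewrite ?norm1_0// /ball1 /= vnorm0// ler01.
Qed.

Definition rep_size Z := norm1 Z.1 + norm1 Z.2 * beta.

Lemma rep_size_ge0 Z : 0 <= rep_size Z.
Proof. by rewrite addr_ge0 ?mulr_ge0 ?norm1_ge0. Qed.

Lemma zset_bound Z x : zset nu Z.1 Z.2 x -> norm1 x <= rep_size Z.
Proof.
move=> [b /ball_beta bb <-]; have := zset_dist Z.1 0 Z.2 0 bb.
by rewrite mul0mx addr0 !subr0.
Qed.

Definition homogeneous_const Z := expR (T * a) * (T * step_const A T) * rep_size Z.

Lemma homogeneous_dist Z i : (i <= N)%N ->
  within_dist (homogeneous_const Z * tau) (zsetr nu (Sseq nu A tau eh Z i))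
     (Rh A (zset nu Z.1 Z.2) (i%:R * tau)) /\
  within_dist (homogeneous_const Z * tau) (Rh A (zset nu Z.1 Z.2) (i%:R * tau))
     (zsetr nu (Sseq nu A tau eh Z i)).
Proof.
move=> iN; have [h1 h2] := iter_Hrep_dist Z Z.1 Z.2 iN.
(* Both sequences start from the same representation, so there is no initial error. *)
rewrite !subrr !norm1_0 !add0r in h1 h2.
have d b : ball1 nu b -> norm1 ((Sseq nu A tau eh Z i).1 + (Sseq nu A tau eh Z i).2 *m b -
    E (i%:R * tau) *m (Z.1 + Z.2 *m b)) <= homogeneous_const Z * tau.
  move=> /ball_beta bb; rewrite mulmxDr mulmxA; apply: (le_trans (zset_dist _ _ _ _ bb)).
  apply: (le_trans (lerD h1 (ler_wpM2r beta0 h2))).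
  by rewrite /homogeneous_const /rep_size [leLHS](_ : _ = homogeneous_const Z * tau)// /homogeneous_const /rep_size; ring.
split=> [_ [b bb <-]|_ [_ [b bb <-] <-]].
  by exists (E (i%:R * tau) *m (Z.1 + Z.2 *m b)); [exists (Z.1 + Z.2 *m b) => //; exists b|exact: d].
exists ((Sseq nu A tau eh Z i).1 + (Sseq nu A tau eh Z i).2 *m b); first by exists b.
by rewrite -norm1N opprB; exact: d.
Qed.

Definition input_const Z :=
  expR (T * a) * ((a + T^-1) * expR (T * a) + T * step_const A T) * rep_size Z.

Lemma input_dist Z i (b : 'cV[R]_p) : (i <= N)%N -> ball1 nu b ->
  norm1 ((Vseq nu A tau eh eu Z i).1 + (Vseq nu A tau eh eu Z i).2 *m b -
    tau *: (E (i%:R * tau) *m (Z.1 + Z.2 *m b))) <= input_const Z * tau ^+ 2.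
Proof.
move=> iN /ball_beta bb.
(* The reference data are scaled by tau: the initial error is of order tau^2 by [Irep_dist], and the
   propagation error gains a second factor tau from the size of the reference. *)
have [h1 h2] := iter_Hrep_dist (Irep nu A tau eu Z) (tau *: Z.1) (tau *: Z.2) iN.
have [g1 g2] := Irep_dist Z.
have nz m (Y : 'M[R]_(n, m)) : norm1 (tau *: Y) = tau * norm1 Y by rewrite norm1Z gtr0_norm.
rewrite -/(Vseq nu A tau eh eu Z i) !nz -!scalemxAr in h1 h2.
rewrite mulmxDr mulmxA scalerDr [tau *: (_ *m b)]scalemxAl; apply: (le_trans (zset_dist _ _ _ _ bb)).
have e0 := expR_ge0 (T * a).
have k1 := le_trans h1 (ler_wpM2l e0 (lerD g1 (lexx _))).
have k2 := le_trans h2 (ler_wpM2l e0 (lerD g2 (lexx _))).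
apply: (le_trans (lerD k1 (ler_wpM2r beta0 k2))).
by rewrite [leLHS](_ : _ = input_const Z * tau ^+ 2)// /input_const /rep_size; ring.
Qed.

Definition forced_const Z := input_const Z + reach_const A (rep_size Z) T.

Lemma input_const_ge0 Z : 0 <= input_const Z.
Proof.
rewrite mulr_ge0 ?rep_size_ge0// mulr_ge0 ?expR_ge0// addr_ge0//.
  by rewrite mulr_ge0 ?expR_ge0// addr_ge0// invr_ge0 ltW.
exact: mulr_ge0 (ltW T0) (step_const_ge0 A T).
Qed.

Lemma forced_const_ge0 Z : 0 <= forced_const Z.
Proof.
by rewrite addr_ge0 ?input_const_ge0//; exact: reach_const_ge0 T0 (rep_size_ge0 Z).
Qed.

Lemma forced_dist_aux Z i : (i <= N)%N ->
  within_dist (i%:R * (forced_const Z * tau ^+ 2)) (Wseq nu A tau eh eu Z i)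
     (Ru A (zset nu Z.1 Z.2) (i%:R * tau)) /\
  within_dist (i%:R * (forced_const Z * tau ^+ 2)) (Ru A (zset nu Z.1 Z.2) (i%:R * tau))
     (Wseq nu A tau eh eu Z i).
Proof.
have cU : convex_set (zset nu Z.1 Z.2) by exact: convex_zset.
have UB := @zset_bound Z.
have B0 := rep_size_ge0 Z.
elim: i => [_|i ih iN].
  rewrite !mul0r; split => [_ ->|y /Ru_zero ->]; exists 0; rewrite ?subrr ?norm1_0//.
  apply: (@Ru_zero_mem _ _ _ _ (Z.1 + Z.2 *m 0)).
  by exists 0 => //; rewrite /ball1 /= vnorm0 ?ler01.
have [ih1 ih2] := ih (ltnW iN).
have it0 : 0 <= i%:R * tau by rewrite mulr_ge0// ltW.
have iT : i%:R * tau + tau <= T.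
  by have := index_le iN; rewrite -natr1 mulrDl mul1r.
rewrite -natr1 ![(_ + 1) * _]mulrDl !mul1r.
(* Serves both inclusions: the same b parametrizes the point of V_i and the point u of the input
   set, so the new errors are those of [input_dist] and of extending or restricting the input. *)
have glue (x' y' x y u : 'cV[R]_n) b : norm1 (x' - y') <= i%:R * (forced_const Z * tau ^+ 2) ->
    ball1 nu b -> u = Z.1 + Z.2 *m b ->
    x = x' + ((Vseq nu A tau eh eu Z i).1 + (Vseq nu A tau eh eu Z i).2 *m b) ->
    norm1 (y - (y' + tau *: (E (i%:R * tau) *m u))) <= reach_const A (rep_size Z) T * tau ^+ 2 ->
    norm1 (x - y) <= i%:R * (forced_const Z * tau ^+ 2) + forced_const Z * tau ^+ 2.
  move=> xy bb -> -> yy; have vv := input_dist Z (ltnW iN) bb.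
  set v := _ + _ *m b in vv *; set e := tau *: _ in vv yy.
  have -> : x' + v - y = (x' - y') + ((v - e) - (y - (y' + e))).
    by apply/matrixP => r s; rewrite !mxE; ring.
  apply: (le_trans (norm1D _ _)); apply: lerD => //.
  apply: (le_trans (norm1D _ _)); rewrite norm1N /forced_const mulrDl.
  exact: lerD.
split.
  move=> _ [x' [v [/ih1[y' Ry' xy'] [b bb <-] ->]]].
  have Uu : zset nu Z.1 Z.2 (Z.1 + Z.2 *m b) by exists b.
  have [y Ry yy] := Ru_extend UB it0 (ltW tau0) iT Ry' Uu.
  by exists y => //; apply: glue xy' bb erefl erefl yy.
move=> y /(Ru_restrict cU UB it0 tau0 iT) [y' [_ [Ry' [b bb <-] yy]]].
have [x' Wx' yx'] := ih2 _ Ry'; rewrite -norm1N opprB in yx'.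
exists (x' + ((Vseq nu A tau eh eu Z i).1 + (Vseq nu A tau eh eu Z i).2 *m b)).
  by exists x', ((Vseq nu A tau eh eu Z i).1 + (Vseq nu A tau eh eu Z i).2 *m b); split => //; exists b.
by rewrite -norm1N opprB; apply: glue yx' bb erefl erefl yy.
Qed.

Lemma forced_dist Z i : (i <= N)%N ->
  within_dist (T * forced_const Z * tau) (Wseq nu A tau eh eu Z i)
     (Ru A (zset nu Z.1 Z.2) (i%:R * tau)) /\
  within_dist (T * forced_const Z * tau) (Ru A (zset nu Z.1 Z.2) (i%:R * tau))
     (Wseq nu A tau eh eu Z i).
Proof.
move=> iN; have [h1 h2] := forced_dist_aux Z iN.
have K : i%:R * (forced_const Z * tau ^+ 2) <= T * forced_const Z * tau.
  rewrite [leLHS](_ : _ = (i%:R * tau) * (forced_const Z * tau)); last by ring.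
  rewrite -(mulrA T); apply: ler_wpM2r; last exact: index_le.
  by rewrite mulr_ge0 ?forced_const_ge0// ltW.
by split; apply: within_dist_le K _.
Qed.

End Algorithm.


(** * Lipschitz dependence of the reachable set on time *)

Section Reach.
Variables (R : realType) (n : nat) (A : 'M[R]_n).

(** Directed backwards in time, as the tube bound moves an arbitrary time down to a grid point. *)
Lemma Rt_lipschitz (X U : set 'cV[R]_n) BX B (T t h : R) : 0 < T ->
  convex_set U -> (forall u, U u -> norm1 u <= B) -> 0 <= B ->
  (forall x, X x -> norm1 x <= BX) ->
  0 <= t -> 0 <= h -> t + h <= T ->
  within_dist ((lip_const A T * BX + (reach_const A B T * T + expR (T * norm1 A) * B)) * h)
    (Rt A X U (t + h)) (Rt A X U t).
Proof.
move=> T0 cU UB B0 XB t0 h0 tT _ [_ [y [[x0 Xx0 <-] Ry ->]]].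
have [y' Ry' yy'] := Ru_lipschitz cU UB T0 B0 t0 h0 tT Ry.
exists (expm (t *: A) *m x0 + y').
  by exists (expm (t *: A) *m x0), y'; split => //; exists x0.
rewrite opprD addrACA mulrDl; apply: le_trans (norm1D _ _) (lerD _ yy').
apply: le_trans (expm_lipschitz A x0 t0 h0 tT) _; rewrite -/(lip_const A T).
rewrite [leRHS]mulrC -mulrA; apply: ler_wpM2l => //.
by apply: ler_wpM2l (XB _ Xx0); exact: lip_const_ge0 (ltW T0).
Qed.

End Reach.

(** * The four error bounds with constants independent of N *)

Unset Implicit Arguments.

Theorem theorem2 (R : realType) (nu : vnorms R) (hnu : forall k, is_norm (nu k))
  (n p q : nat) (A : 'M[R]_n) (T : R) (hT : 0 < T)
  (c0 : 'cV[R]_n) (G0 : 'M[R]_(n, p)) (hG0 : \rank G0 = n)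
  (cu : 'cV[R]_n) (Gu : 'M[R]_(n, q)) (hGu : \rank Gu = n) :
  exists D1 D2 D3 D4 : R,
    [/\ 0 <= D1, 0 <= D2, 0 <= D3 & 0 <= D4] /\
    forall N : nat, (0 < N)%N ->
      let tau := T / N%:R in
      let eh := 1 - (N%:R ^+ 2)^-1 in
      let eu := 1 - N%:R^-1 in
      Iset A tau -> tau * opnorm nu A <= 1 ->
      (forall i : nat, (i <= N)%N ->
        [/\ (hausdorff nu (zsetr nu (Sseq nu A tau eh (c0, G0) i))
                (Rh A (zset nu c0 G0) (i%:R * tau)) <= (D1 * tau)%:E)%E,
            (hausdorff nu (Wseq nu A tau eh eu (cu, Gu) i)
                (Ru A (zset nu cu Gu) (i%:R * tau)) <= (D2 * tau)%:E)%E &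
            (hausdorff nu (Lam nu A tau eh eu (c0, G0) (cu, Gu) i)
                (Rt A (zset nu c0 G0) (zset nu cu Gu) (i%:R * tau)) <= (D3 * tau)%:E)%E])
      /\
      (hausdorff nu [set x | exists2 i, (i <= N)%N & Lam nu A tau eh eu (c0, G0) (cu, Gu) i x]
          (Rreach A (zset nu c0 G0) (zset nu cu Gu) T) <= (D4 * tau)%:E)%E.
Proof.
have [C C0 nuC] := vnorm_le_norm1 hnu n.
have ball_bound k : exists beta : R, forall b : 'cV[R]_k, ball1 nu b -> norm1 b <= beta.
  have [M M0 hM] := norm1_le_vnorm hnu k; exists M => b bb.
  by apply: (le_trans (hM b)); rewrite ler_piMr// ltW.
have [bp Bp] := ball_bound p; have [bq Bq] := ball_bound q.
have SX := rep_size_ge0 hnu Bp (c0, G0); have SU := rep_size_ge0 hnu Bq (cu, Gu).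
pose K1 := homogeneous_const A T bp (c0, G0).
pose K2 := T * forced_const A T bq (cu, Gu).
(* The error at grid times plus the Lipschitz constant of the reachable set in time. *)
pose K4 := K1 + K2 + (lip_const A T * rep_size bp (c0, G0)
  + (reach_const A (rep_size bq (cu, Gu)) T * T + expR (T * norm1 A) * rep_size bq (cu, Gu))).
have K10 : 0 <= K1.
  by rewrite mulr_ge0// mulr_ge0 ?expR_ge0//; exact: mulr_ge0 (ltW hT) (step_const_ge0 A T).
have K20 : 0 <= K2.
  exact: mulr_ge0 (ltW hT) (forced_const_ge0 hnu A hT Bq (cu, Gu)).
have K30 : 0 <= K1 + K2 by rewrite addr_ge0.
have K40 : 0 <= lip_const A T * rep_size bp (c0, G0)
  + (reach_const A (rep_size bq (cu, Gu)) T * T + expR (T * norm1 A) * rep_size bq (cu, Gu)).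
  rewrite addr_ge0//; first exact: mulr_ge0 (lip_const_ge0 A (ltW hT)) SX.
  rewrite addr_ge0//; first exact: mulr_ge0 (reach_const_ge0 A hT SU) (ltW hT).
  by rewrite mulr_ge0 ?expR_ge0.
have D0 K : 0 <= K -> 0 <= C * K + 1 by move=> K0; rewrite addr_ge0// mulr_ge0// ltW.
(* C passes from [norm1] to [nu]; the + 1 keeps the radius positive, as [hausdorff_le] requires,
   even when the error constant is 0. *)
exists (C * K1 + 1), (C * K2 + 1), (C * (K1 + K2) + 1), (C * K4 + 1).
split; first by split; apply: D0 => //; exact: addr_ge0.
move=> N N0 tau eh eu tauI _.
have tau0 : 0 < tau by rewrite divr_gt0// ltr0n.
have dist K (X Y : set 'cV[R]_n) : 0 <= K -> within_dist (K * tau) X Y -> within_dist (K * tau) Y X ->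
    (hausdorff nu X Y <= ((C * K + 1) * tau)%:E)%E.
  move=> K0 XY YX; apply: (hausdorff_le hnu nuC (ltW C0) _ _ XY YX).
    by rewrite mulr_gt0// ltr_wpDl// mulr_ge0// ltW.
  by rewrite mulrA mulrDl mul1r lerDl ltW.
have H i (iN : (i <= N)%N) := homogeneous_dist hnu A hT N0 Bp (c0, G0) iN.
have F i (iN : (i <= N)%N) := forced_dist hnu hT N0 tauI Bq (cu, Gu) iN.
have L i : (i <= N)%N ->
    within_dist ((K1 + K2) * tau) (Lam nu A tau eh eu (c0, G0) (cu, Gu) i)
      (Rt A (zset nu c0 G0) (zset nu cu Gu) (i%:R * tau)) /\
    within_dist ((K1 + K2) * tau) (Rt A (zset nu c0 G0) (zset nu cu Gu) (i%:R * tau))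
      (Lam nu A tau eh eu (c0, G0) (cu, Gu) i).
  move=> iN; have [h1 h2] := H i iN; have [f1 f2] := F i iN.
  by rewrite mulrDl; split; exact: within_dist_msum.
have iT i : (i <= N)%N -> 0 <= i%:R * tau <= T.
  move=> iN; rewrite mulr_ge0 ?(ltW tau0)//= /tau mulrA ler_pdivrMr ?ltr0n//.
  by rewrite [leRHS]mulrC ler_pM2r// ler_nat.
split=> [i iN|].
  have [h1 h2] := H i iN; have [f1 f2] := F i iN; have [l1 l2] := L i iN.
  by split; apply: dist.
apply: dist; first exact: addr_ge0.
- move=> x [i iN /(L i iN).1[y Ry xy]]; exists y; first by exists (i%:R * tau); split; [exact: iT|].
  apply: (le_trans xy); apply: ler_wpM2r; first exact: ltW.
  by rewrite lerDl.
- move=> x [t [/andP[t0 tT] Rx]].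
  have q0 : 0 <= t / tau by rewrite divr_ge0// ltW.
  have /andP[i1 i2] := truncn_itv q0.
  (* The last grid index with i tau <= t; it is at most N because t <= T = N tau, and t - i tau <
     tau. *)
  set i := Num.truncn _ in i1 i2.
  rewrite ler_pdivlMr// in i1; rewrite ltr_pdivrMr// -natr1 mulrDl mul1r in i2.
  have iN : (i <= N)%N.
    rewrite -(ler_nat R) -(ler_pM2r tau0); apply: (le_trans i1); apply: (le_trans tT).
    by rewrite /tau mulrCA mulfV ?mulr1// pnatr_eq0 -lt0n.
  have /andP[it0 _] := iT i iN.
  have h0 : 0 <= t - i%:R * tau by rewrite subr_ge0.
  have ht : t - i%:R * tau <= tau by rewrite lerBlDl ltW.
  have te : i%:R * tau + (t - i%:R * tau) = t by rewrite addrC subrK.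
  have := @Rt_lipschitz R n A (zset nu c0 G0) (zset nu cu Gu) _ _ T (i%:R * tau) (t - i%:R * tau) hT
    (@convex_zset R n nu hnu q cu Gu) (@zset_bound R nu n q bq Bq (cu, Gu)) SU
    (@zset_bound R nu n p bp Bp (c0, G0)) it0 h0.
  rewrite te => /(_ tT x Rx) [y Ry xy].
  have [z Lz yz] := (L i iN).2 y Ry.
  exists z; first by exists i.
  apply: (le_trans (norm1_sub x y z)); rewrite /K4 addrC [leRHS]mulrDl; apply: lerD => //.
  by apply: (le_trans xy); exact: ler_wpM2l.
Qed.
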